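(* There exists an infinite-dimensional separable Banach space $X$ such that every countable dense set $S\subseteq X$ is strongly non-Rado.
   Context: All normed spaces are real. Let $S$ be a countable dense set in a normed space $X$, and let $p$ be a fixed probability with $0<p<1$. The random graph $G(S,p)$ has vertex set $S$; each pair of distinct points $x,y\in S$ with $\|x-y\|<1$ is joined by an edge with probability $p$, independently over all such pairs, and no other pairs are joined. The set $S$ is strongly non-Rado if any two such random graphs are almost surely non-isomorphic (as abstract graphs), i.e. two independent samples of $G(S,p)$ are non-isomorphic with probability $1$. *)

(* Defs.v *)
From mathcomp Require Import all_boot all_order all_algebra finmap.
From mathcomp Require Import all_classical all_reals all_analysis.
Set Implicit Arguments.
Unset Strict Implicit.
Unset Printing Implicit Defensive.
Import Order.TTheory GRing.Theory Num.Theory.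
Import numFieldNormedType.Exports.
Local Open Scope fset_scope.
Local Open Scope classical_set_scope.
Local Open Scope ring_scope.

Definition finite_dimensional (R : realType) (X : normedModType R) : Prop :=
  exists (n : nat) (v : 'I_n -> X), forall x : X,
    exists c : 'I_n -> R, x = \sum_(i < n) c i *: v i.

Definition infinite_dimensional (R : realType) (X : normedModType R) : Prop :=
  ~ finite_dimensional X.

Definition separable (X : topologicalType) : Prop :=
  exists D : set X, countable D /\ dense D.

(* A graph on the vertex set V is represented by its set of edges, an edge
   being an unordered pair [fset x; y] with x != y; the singletons
   [fset x; x] are not edges of the graphs considered here. *)
Definition graph_isomorphic (V : choiceType) (G H : set {fset V}) : Prop :=
  exists2 f : V -> V, bijective f &
    forall x y : V, G [fset x; y] <-> H [fset f x; f y].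

(* Points of S carry a proof of membership; val forgets it. *)
Definition close_pairs (R : realType) (X : normedModType R) (S : set X) :
    set {fset S} :=
  [set e | exists x y : S,
     [/\ e = [fset x; y], x != y & `|val x - val y| < 1]].
Arguments close_pairs {R X} S.

Definition edge_event (T : Type) (V : choiceType) (G : T -> set {fset V})
    (e : {fset V}) : set T :=
  [set w | G w e].

Definition mutually_independent (R : realType) (d : measure_display)
    (T : measurableType d) (P : probability T R) (I : choiceType)
    (D : set I) (A : I -> set T) : Prop :=
  forall F : {fset I}, (forall i, i \in F -> D i) ->
    P (\bigcap_(i in [set` F]) A i) = (\prod_(i <- F) P (A i))%E.

Definition is_random_graph (R : realType) (d : measure_display)
    (T : measurableType d) (P : probability T R) (X : normedModType R)
    (S : set X) (p : R) (G : T -> set {fset S}) : Prop :=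
  [/\ forall w, G w `<=` close_pairs S,
      forall e, close_pairs S e -> measurable (edge_event G e),
      forall e, close_pairs S e -> P (edge_event G e) = p%:E
    & mutually_independent P (close_pairs S) (edge_event G)].

(* The sigma-algebra on T generated by a random graph. *)
Definition sigma_graph (T : Type) (V : choiceType) (G : T -> set {fset V}) :
    set (set T) :=
  <<s range (edge_event G) >>.

Definition independent_graphs (R : realType) (d : measure_display)
    (T : measurableType d) (P : probability T R) (V : choiceType)
    (G H : T -> set {fset V}) : Prop :=
  forall A B : set T, sigma_graph G A -> sigma_graph H B ->
    P (A `&` B) = (P A * P B)%E.

(* The almost sure statement is in terms of negligible sets: the event of
   being isomorphic is an uncountable union over bijections and is not
   assumed to be measurable. *)
Definition strongly_non_Rado (R : realType) (X : normedModType R) (p : R)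
    (S : set X) : Prop :=
  forall (d : measure_display) (T : measurableType d) (P : probability T R)
         (G H : T -> set {fset S}),
    is_random_graph P p G -> is_random_graph P p H ->
    independent_graphs P G H ->
    {ae P, forall w, ~ graph_isomorphic (G w) (H w)}.

(* Main.v *)
(** Two points x, y of S almost surely have a common neighbour in G(S,p)
    exactly when |x - y| < 2, so an isomorphism f between two samples
    preserves the relation |x - y| < 2 and, S being dense, |x - y| < 2k for
    every k. Looking at f from a point z going to infinity, the balls around
    z become half-spaces when X is uniformly smooth: every functional phi of
    norm one has a companion psi such that psi (f x) depends monotonically on
    phi x, up to a bounded error. As this holds for all phi, psi (f x - f y) is
    a multiple of phi (x - y), by a factor which is first independent of phi,
    then of x and y, and then equal to 1. Hence f is the restriction of an
    affine isometry of X.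

    If the only linear isometries of X are the identity and its opposite,
    there are only countably many candidates x |-> s +- (x - x0) for f, and each
    of them maps infinitely many possible edges at x0 to possible edges at s,
    so that it is almost surely not an isomorphism.

    Such a space is found inside l4, where disjointness of supports is a metric
    relation (the equality case of Clarkson's inequality). On a suitable
    subspace it encodes the adjacency of the half-line 0 - 1 - 2 - ..., a graph
    without nontrivial automorphism. *)
Require Import Defs.
From HB Require Import structures.
From mathcomp Require Import all_boot all_order all_algebra finmap.
From mathcomp Require Import all_classical all_reals all_analysis.
From mathcomp Require Import ring lra zify.
Set Implicit Arguments.
Unset Strict Implicit.
Unset Printing Implicit Defensive.
Import Order.TTheory GRing.Theory Num.Theory.
Import numFieldNormedType.Exports.
Local Open Scope classical_set_scope.
Local Open Scope ring_scope.

(** An isomorphism controls distances only up to an additive constant, since it sees nothing finer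
    than multiples of 2. Such errors disappear for linear functionals: a bounded functional that
    stays bounded on a dense set is zero, so the companion psi of phi is unique and depends linearly
    on phi. By uniqueness psi is also the same for every offset s of the hyperplanes phi = s + 2n
    used to find it, and varying s turns a bounded error into exact monotonicity. Limits are taken
    along an ultrafilter, so that the normalised distances to all points converge at once.

    Permutations and sign changes of the coordinates are isometries of l4. Each odd coordinate links
    two consecutive free ones: this restricts the permutations to automorphisms of the half-line and
    ties the signs of neighbours together. With exponent 4 the norm is governed by polynomial
    identities, and the single identity (x + y)^4 + (x - y)^4 = 2 x^4 + 2 y^4 + 12 x^2 y^2 yields
    both the smoothness and the metric test for disjoint supports. *)

Lemma dense_normP (R : realType) (X : normedModType R) (S : set X) :
  dense S <-> forall (x : X) (e : R), 0 < e -> exists2 s, S s & `|x - s| < e.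
Proof.
split=> [dS x e e0|H O [x Ox] oO].
  have [s [xs Ss]] : ball x e `&` S !=set0.
    by apply: dS; [exists x; exact: ballxx|exact: ball_open].
  by exists s => //; move: xs; rewrite -ball_normE.
have /nbhs_ballP[e /= e0 xO] : nbhs x O by exact: open_nbhs_nbhs.
have [s Ss xs] := H x e e0; exists s; split=> //.
by apply: xO; rewrite -ball_normE.
Qed.

Definition linear_isometry (R : realType) (X : normedModType R) (T : X -> X) :=
  (forall (a : R) x y, T (a *: x + y) = a *: T x + T y) /\ (forall x, `|T x| = `|x|).

(** Dividing by |w| and putting t = 1/|w|, u = w/|w|, this reads |u + t y| + |u - t y| <= 2 + e t
    for small t, uniformly in the unit vector u but for each fixed direction y. The form at large
    scale is the one met when w is a far centre. *)
Definition uniformly_smooth (R : realType) (X : normedModType R) :=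
  forall (y : X) (e : R), 0 < e ->
    exists M : R, forall w : X, M <= `|w| -> `|w + y| + `|w - y| <= 2 * `|w| + e.

(** * Busemann functions of uniformly smooth spaces *)

(** Compactness of [-K, K] gives the image filter a cluster point, and for an ultrafilter a cluster
    point is a limit: a set or its complement belongs to [F]. *)
Lemma ultra_bounded_cvg (R : realType) (I : Type) (F : set_system I) (FU : UltraFilter F)
  (f : I -> R) (K : R) : (forall i, `|f i| <= K) -> exists l : R, f i @[i --> F] --> l.
Proof.
move=> fK; have FF : ProperFilter F := @ultra_proper _ _ FU.
have [p [_ pc]] : [set` `[- K, K]%R] `&` cluster (f @ F) !=set0.
  apply: (@segment_compact R (- K) K (f @ F)).
  have : \forall i \near F, f i \in `[- K, K].
    by apply: nearW => i; rewrite in_itv /= -ler_norml.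
  exact.
exists p => V Vp.
have [//|FC] := in_ultra_setVsetC (f @^-1` V) FU.
have [q [/= Wq Vq]] : (f @` (~` (f @^-1` V))) `&` V !=set0.
  apply: pc => //; have : \forall i \near F, (f @` (~` (f @^-1` V))) (f i).
    by apply: filterS FC => i Vi; exists i.
  exact.
by case: Wq => i Vi fi; case: Vi; rewrite /= fi.
Qed.

Lemma exists_nat_ge (R : realType) (x : R) : exists n : nat, x <= n%:R.
Proof.
exists (Num.bound `|x|); apply: le_trans (ler_norm x) _.
by apply: ltW; exact: archi_boundP.
Qed.

Lemma limit_le (R : realType) (I : Type) (F : set_system I) {FF : ProperFilter F}
    (f g : I -> R) (l m : R) :
  f i @[i --> F] --> l -> g i @[i --> F] --> m ->
  (\forall i \near F, f i <= g i) -> l <= m.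
Proof.
move=> fl gm fg; rewrite -subr_ge0.
have h : g i - f i @[i --> F] --> m - l by exact: cvgB.
by apply: (cvgr_to_ge h); apply: filterS fg => i; rewrite subr_ge0.
Qed.

Section functionals.
Variables (R : realType) (X : normedModType R).
Implicit Types (x y z : X) (phi psi : X -> R) (C : R).

Definition bounded_linear C phi :=
  (forall (a : R) x y, phi (a *: x + y) = a * phi x + phi y) /\
  (forall x, phi x <= C * `|x|).

Lemma blinD C phi x y : bounded_linear C phi -> phi (x + y) = phi x + phi y.
Proof. by move=> [h _]; have := h 1 x y; rewrite scale1r mul1r. Qed.

Lemma blin0 C phi : bounded_linear C phi -> phi 0 = 0.
Proof. by move=> h; apply: (@addrI _ (phi 0)); rewrite -(blinD _ _ h) !addr0. Qed.

Lemma blinZ C phi (a : R) x : bounded_linear C phi -> phi (a *: x) = a * phi x.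
Proof. by move=> h; have := h.1 a x 0; rewrite (blin0 h) !addr0. Qed.

Lemma blinN C phi x : bounded_linear C phi -> phi (- x) = - phi x.
Proof. by move=> h; rewrite -scaleN1r (blinZ _ _ h) mulN1r. Qed.

Lemma blinB C phi x y : bounded_linear C phi -> phi (x - y) = phi x - phi y.
Proof. by move=> h; rewrite (blinD _ _ h) (blinN _ h). Qed.

Lemma blin_norm C phi x : bounded_linear C phi -> `|phi x| <= C * `|x|.
Proof.
move=> h; rewrite ler_norml h.2 andbT.
by have := h.2 (- x); rewrite (blinN _ h) normrN; lra.
Qed.

Lemma blin_comb C D phi psi (a : R) : bounded_linear C phi -> bounded_linear D psi ->
  bounded_linear (`|a| * C + D) (fun x => a * phi x + psi x).
Proof.
move=> h k; split=> [t x y|x]; first by rewrite h.1 k.1; ring.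
rewrite mulrDl lerD ?k.2 // -mulrA; apply: le_trans (ler_norm _) _.
by rewrite normrM ler_wpM2l // blin_norm.
Qed.

Lemma blin_scale C phi (a : R) : bounded_linear C phi ->
  bounded_linear (`|a| * C) (fun x => a * phi x).
Proof.
move=> h; split=> [t x y|x]; first by rewrite h.1; ring.
rewrite -mulrA; apply: le_trans (ler_norm _) _.
by rewrite normrM ler_wpM2l // blin_norm.
Qed.

(** The midpoint identity gives additivity. Homogeneity for 0 <= t <= 1 comes from concavity along
    rays, applied to both x and -x; larger t follow by inversion. *)
Lemma midpoint_linear phi C : phi 0 = 0 ->
  (forall x y, phi (x + y) + phi (x - y) = 2 * phi x) ->
  (forall x (t : R), 0 <= t <= 1 -> t * phi x <= phi (t *: x)) ->
  (forall x, phi x <= C * `|x|) -> bounded_linear C phi.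
Proof.
move=> p0 mid conc bnd; split=> //.
have p2 x : phi (2 *: x) = 2 * phi x.
  by have := mid x x; rewrite subrr p0 addr0 scaler_nat mulr2n.
have add x y : phi (x + y) = phi x + phi y.
  have := mid (2^-1 *: (x + y)) (2^-1 *: (x - y)).
  rewrite -scalerDr -scalerBr -p2.
  have -> : x + y + (x - y) = 2 *: x by rewrite scaler_nat mulr2n addrACA subrr addr0.
  have -> : x + y - (x - y) = 2 *: y.
    by rewrite scaler_nat mulr2n opprB [x + y]addrC addrACA subrr addr0.
  by rewrite !scalerA mulfV // mulVf // !scale1r.
have opp x : phi (- x) = - phi x.
  by apply/eqP; rewrite -addr_eq0 -add addNr p0.
have pos01 x (t : R) : 0 <= t <= 1 -> phi (t *: x) = t * phi x.
  move=> t01; apply/eqP; rewrite eq_le conc // andbT.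
  by have := conc (- x) t t01; rewrite scalerN !opp mulrN; lra.
have pos x (t : R) : 0 <= t -> phi (t *: x) = t * phi x.
  move=> t0; have [t1|t1] := leP t 1; first by rewrite pos01 // t0 t1.
  have t0' : t != 0 by rewrite gt_eqF // (lt_trans ltr01).
  have : phi (t^-1 *: (t *: x)) = t^-1 * phi (t *: x).
    apply: pos01; rewrite invr_ge0 t0 /= invf_le1 ?ltW //.
    exact: lt_trans ltr01 t1.
  by rewrite scalerA mulVf // scale1r => ->; rewrite mulrA mulfV // mul1r.
move=> a x y; rewrite add; congr (_ + _).
have [a0|a0] := leP 0 a; first exact: pos.
rewrite -[a]opprK scaleNr opp pos ?mulNr // oppr_ge0 ltW //.
Qed.

Hypothesis US : uniformly_smooth X.

(* The Busemann function of a sequence going to infinity: by uniform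
   smoothness it is both convex and midpoint concave, hence affine. *)
Lemma horofunction (F : set_system nat) (FU : UltraFilter F) (w : nat -> X)
    (a : nat -> R) (K : R) :
  (forall M : R, \forall j \near F, M <= `|w j|) ->
  (forall j, `| `|w j| - a j| <= K) ->
  exists tau phi, bounded_linear 1 phi /\
    forall y, `|w j - y| - a j @[j --> F] --> tau - phi y.
Proof.
move=> winf wa; have FF : ProperFilter F := @ultra_proper _ _ FU.
have ex y : exists l : R, `|w j - y| - a j @[j --> F] --> l.
  apply: (@ultra_bounded_cvg _ _ F FU _ (K + `|y|)) => j.
  have -> : `|w j - y| - a j = (`|w j| - a j) + (`|w j - y| - `|w j|) by ring.
  apply: le_trans (ler_normD _ _) _; apply: lerD; first exact: wa.
  apply: le_trans (ler_dist_dist _ _) _.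
  by rewrite addrAC subrr add0r normrN.
have [b bP] := choice ex.
have lip y y' : b y <= b y' + `|y - y'|.
  apply: (@limit_le _ _ F _ (fun j => `|w j - y| - a j)
    (fun j => (`|w j - y'| - a j) + `|y - y'|)); first exact: bP.
    by apply: cvgD; [exact: bP|exact: cvg_cst].
  apply: nearW => j; rewrite addrAC lerD2r.
  have -> : w j - y = (w j - y') + (y' - y) by rewrite addrA subrK.
  by rewrite (distrC y y') ler_normD.
have conv y (t : R) : 0 <= t <= 1 -> b (t *: y) <= t * b y + (1 - t) * b 0.
  move=> /andP[t0 t1].
  apply: (@limit_le _ _ F _ (fun j => `|w j - t *: y| - a j)
    (fun j => t * (`|w j - y| - a j) + (1 - t) * (`|w j - 0| - a j))); first exact: bP.
    by apply: cvgD; apply: cvgMr; exact: bP.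
  apply: nearW => j; rewrite subr0.
  have -> : t * (`|w j - y| - a j) + (1 - t) * (`|w j| - a j) =
     t * `|w j - y| + (1 - t) * `|w j| - a j by ring.
  rewrite lerD2r.
  have -> : w j - t *: y = t *: (w j - y) + (1 - t) *: w j.
    by rewrite scalerBr scalerBl scale1r [RHS]addrC addrA subrK.
  apply: le_trans (ler_normD _ _) _.
  by rewrite !normrZ !ger0_norm ?subr_ge0.
have mid y h : b (y + h) + b (y - h) = 2 * b y.
  have wh j : w j - (y - h) = w j - y + h by rewrite opprB addrCA addrC.
  have wh' j : w j - (y + h) = w j - y - h by rewrite opprD addrA.
  have c2 : (`|w j - (y + h)| - a j) + (`|w j - (y - h)| - a j) @[j --> F] -->
      b (y + h) + b (y - h) by apply: cvgD; exact: bP.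
  have c1 : 2 * (`|w j - y| - a j) @[j --> F] --> 2 * b y by apply: cvgMr; exact: bP.
  apply/eqP; rewrite eq_le; apply/andP; split.
    apply/ler_addgt0Pr => e e0.
    apply: (@limit_le _ _ F _ _ (fun j => 2 * (`|w j - y| - a j) + e) _ _ c2).
      by apply: cvgD c1 _; exact: cvg_cst.
    have [M MP] := US h e0.
    apply: filterS (winf (M + `|y|)) => j Mj.
    have := MP (w j - y).
    rewrite -wh -wh' => H; suff /H : M <= `|w j - y| by lra.
    by have := lerB_dist (w j) y; lra.
  apply: (limit_le c1 c2); apply: nearW => j.
  have : `|2 *: (w j - y)| <= `|w j - (y + h)| + `|w j - (y - h)|.
    have -> : 2 *: (w j - y) = (w j - (y + h)) + (w j - (y - h)).
      by rewrite wh wh' [RHS]addrACA addNr addr0 scaler_nat mulr2n.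
    exact: ler_normD.
  by rewrite normrZ ger0_norm //; lra.
exists (b 0), (fun y => b 0 - b y); split; last first.
  by move=> y; rewrite opprB addrCA subrr addr0; exact: bP.
apply: midpoint_linear => [|x y|x t t01|x].
- by rewrite subrr.
- by have := mid x y; lra.
- by have := conv x t t01; lra.
- by have := lip 0 x; rewrite sub0r normrN; lra.
Qed.

(** The functional is read off the Busemann function of the ray j u, whose value at u is known
    exactly: |j u - u| - j |u| = -|u| for j >= 1. *)
Lemma norming u : exists2 phi, bounded_linear 1 phi & phi u = `|u|.
Proof.
have [->|u0] := eqVneq u 0.
  exists (fun _ => 0); last by rewrite normr0.
  by split=> [a x y|x]; rewrite ?mulr0 ?addr0 // mul1r.
have [F [FU Foo]] := ultraFilterLemma (F := \oo) _.
have FF : ProperFilter F := @ultra_proper _ _ FU.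
pose w (j : nat) := j%:R *: u.
have nw j : `|w j| = j%:R * `|u| by rewrite normrZ ger0_norm.
have [|j|tau [phi [phiL phiP]]] := @horofunction F FU w (fun j => j%:R * `|u|) 0.
- move=> M; have [n Mn] := exists_nat_ge (M / `|u|).
  apply: Foo; exists n => // j /= nj; rewrite nw -ler_pdivrMr ?normr_gt0 //.
  by apply: le_trans Mn _; rewrite ler_nat.
- by rewrite nw subrr normr0.
exists phi => //.
have lim (l : R) y : (\forall j \near F, `|w j - y| - j%:R * `|u| = l) -> tau - phi y = l.
  move=> h; apply: (cvg_unique (@norm_hausdorff _ R) (phiP y)).
  exact: cvg_near_cst.
have tau0 : tau = 0.
  rewrite -(@lim 0 0) ?(blin0 phiL) ?subr0 //; apply: nearW => j.
  by rewrite subr0 nw subrr.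
have := lim (- `|u|) u; rewrite tau0 sub0r => H; apply: oppr_inj; apply: H.
apply: Foo; exists 1%N => // j /= j1.
have -> : w j - u = (j%:R - 1) *: u by rewrite scalerBl scale1r.
by rewrite normrZ ger0_norm ?subr_ge0 ?ler1n //; ring.
Qed.

End functionals.

(** * Bijections preserving the distances below a threshold *)

(** The maps are total on X, with arbitrary values off S, so that the algebra of X applies to them
    directly. For graph isomorphisms r is 2. *)
Definition step_pair (R : realType) (X : normedModType R) (S : set X) (r : R)
    (f g : X -> X) :=
  [/\ forall x, S x -> S (f x), forall x, S x -> S (g x),
      forall x, S x -> g (f x) = x, forall x, S x -> f (g x) = x
    & forall x y, S x -> S y -> (`|x - y| < r <-> `|f x - f y| < r)].

Lemma step_pair_sym (R : realType) (X : normedModType R) (S : set X) (r : R)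
    (f g : X -> X) : step_pair S r f g -> step_pair S r g f.
Proof.
move=> [fS gS fK gK fr]; split=> // x y Sx Sy.
by have := fr _ _ (gS _ Sx) (gS _ Sy); rewrite !gK // => -[h1 h2]; split.
Qed.

Section step_distances.
Variables (R : realType) (X : normedModType R) (S : set X) (r : R) (f g : X -> X).
Hypotheses (dS : dense S) (r0 : 0 < r) (fg : step_pair S r f g).

(** Distance below a multiple of r means being joined by that many jumps shorter than r; by density
    the intermediate points can be taken in S. *)
Lemma step_mul k x y : S x -> S y ->
  `|x - y| < k.+1%:R * r -> `|f x - f y| < k.+1%:R * r.
Proof.
have [fS _ _ _ fr] := fg.
elim: k x y => [|k IHk] x y Sx Sy xy; first by rewrite mul1r -fr // -[r]mul1r.
set d := `|x - y| in xy; pose q : R := k.+2%:R.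
have q0 : 0 < q by rewrite ltr0n.
have qE : k.+1%:R = q - 1 by rewrite /q -[k.+2]addn1 natrD addrK.
(* Each of the q = k + 2 equal pieces of the segment has length d / q < r; [delta] is the room left
   for moving the first division point [p] into S. *)
pose delta := r - d / q.
have delta0 : 0 < delta by rewrite subr_gt0 ltr_pdivrMr // mulrC.
pose p := x + q^-1 *: (y - x).
have [z Sz pz] := (dense_normP S).1 dS p delta delta0.
have xp : `|x - p| = d / q.
  by rewrite /p opprD addrA subrr sub0r normrN normrZ ger0_norm ?invr_ge0 ?ltW // distrC mulrC.
have py : `|p - y| = (q - 1) * (d / q).
  have -> : p - y = (1 - q^-1) *: (x - y).
    rewrite /p scalerBl scale1r addrAC; congr (_ + _).
    by rewrite -scalerN opprB.
  rewrite normrZ ger0_norm; first by rewrite -/d; field; rewrite gt_eqF.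
  by rewrite subr_ge0 invf_le1 // ler1n.
have xz : `|x - z| < r.
  have -> : x - z = (x - p) + (p - z) by rewrite addrA subrK.
  by apply: le_lt_trans (ler_normD _ _) _; rewrite xp -ltrBrDl.
have zy : `|z - y| < k.+1%:R * r.
  have -> : z - y = (z - p) + (p - y) by rewrite addrA subrK.
  apply: le_lt_trans (ler_normD _ _) _; rewrite py qE distrC.
  apply: lt_le_trans (_ : delta + (q - 1) * (d / q) <= _); first by rewrite ltrD2r.
  rewrite -subr_ge0 /delta.
  have -> : (q - 1) * r - (r - d / q + (q - 1) * (d / q)) = (q - 2) * delta.
    by rewrite /delta; ring.
  by apply: mulr_ge0; [rewrite subr_ge0 /q ler_nat|exact: ltW].
have -> : f x - f y = (f x - f z) + (f z - f y) by rewrite addrA subrK.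
apply: le_lt_trans (ler_normD _ _) _.
have -> : q * r = r + (q - 1) * r by ring.
by apply: ltrD; [rewrite -fr|rewrite -qE; apply: IHk].
Qed.

Lemma step_int (k : int) x y : S x -> S y ->
  `|x - y| < k%:~R * r -> `|f x - f y| < k%:~R * r.
Proof.
move=> Sx Sy xy; have : 0 < k%:~R * r by apply: le_lt_trans xy.
rewrite pmulr_lgt0 // ltr0z => k0; move: xy; case: k k0 => [[|k]|k] // _.
exact: step_mul.
Qed.

Lemma step_dist x y : S x -> S y -> `|f x - f y| <= `|x - y| + r.
Proof.
move=> Sx Sy; set d := `|x - y|.
have d0 : 0 <= d / r by rewrite divr_ge0 /d // ltW.
have /andP[h1 h2] := truncn_itv d0.
have /ltW h : `|f x - f y| < (Num.truncn (d / r)).+1%:R * r.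
  by apply: step_mul => //; rewrite -ltr_pdivrMr.
apply: le_trans h _; move: h1; rewrite ler_pdivlMr // => h1.
by rewrite -[_.+1]addn1 natrD mulrDl mul1r; lra.
Qed.

End step_distances.

Lemma step_dist2 (R : realType) (X : normedModType R) (S : set X) (r : R) (f g : X -> X) :
  dense S -> 0 < r -> step_pair S r f g ->
  forall x y, S x -> S y -> `| `|f x - f y| - `|x - y| | <= r.
Proof.
move=> dS r0 fg x y Sx Sy; have [fS gS fK gK fr] := fg.
have h1 := step_dist dS r0 fg Sx Sy.
have h2 := step_dist dS r0 (step_pair_sym fg) (fS _ Sx) (fS _ Sy).
by rewrite !fK // in h2; rewrite ler_norml; lra.
Qed.

(** * Half-spaces as limits of balls *)

Section halfspaces.
Variables (R : realType) (X : normedModType R) (S : set X) (r : R) (f g : X -> X).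
Hypotheses (US : uniformly_smooth X) (dS : dense S) (r0 : 0 < r) (fg : step_pair S r f g).

(** The norm is exactly 1 but possibly not attained; almost norming vectors are enough to build
    sequences going to infinity. *)
Definition norm_one (phi : X -> R) :=
  bounded_linear 1 phi /\
  forall e : R, 0 < e -> exists2 u, `|u| = 1 & 1 - e <= phi u.

(** [z j] approximates A u with A = s + (m j) r and u a unit vector depending on j, with phi u so
    close to 1 that the loss stays small after multiplication by A. As |z j| is close to s modulo r,
    the threshold distance (m j - n) r from [z j] becomes the hyperplane phi = s + n r in the
    limit. *)
Lemma halfspaces_seq phi (s : R) : norm_one phi -> exists (z : nat -> X) (m : nat -> nat),
  forall j, [/\ S (z j), (j <= m j)%N,
    `| `|z j| - (s + (m j)%:R * r) | <= harmonic j & `|z j| - harmonic j <= phi (z j)].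
Proof.
move=> [phiL phi1].
suff h j : exists zm : X * nat, [/\ S zm.1, (j <= zm.2)%N,
    `| `|zm.1| - (s + zm.2%:R * r) | <= (harmonic j : R) & `|zm.1| - harmonic j <= phi zm.1].
  have [zm zmP] := choice h.
  by exists (fun j => (zm j).1), (fun j => (zm j).2).
move: (harmonic j : R) (@harmonic_gt0 R j) => H h0.
have [n nP] := exists_nat_ge ((`|s| + 1) / r).
pose m := (j + n)%N; pose A := s + m%:R * r.
have A1 : 0 < A.
  rewrite ler_pdivrMr // in nP.
  have mr : n%:R * r <= m%:R * r by rewrite ler_pM2r // ler_nat leq_addl.
  by have := ler_norm (- s); rewrite normrN /A; lra.
pose d : R := H / 4.
have d0 : 0 < d by rewrite divr_gt0.
have [u u1 phiu] := phi1 (d / A) (divr_gt0 d0 A1).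
have [z Sz pz] := (dense_normP S).1 dS (A *: u) d d0.
have nAu : `|A *: u| = A by rewrite normrZ u1 mulr1 ger0_norm // ltW.
have phiAu : A - d <= phi (A *: u).
  rewrite (blinZ _ _ phiL).
  have : A * (1 - d / A) <= A * phi u by rewrite ler_pM2l.
  by have -> : A * (1 - d / A) = A - d by field; rewrite gt_eqF.
have zA : `| `|z| - A | <= d.
  by rewrite -{1}nAu; apply: le_trans (ler_dist_dist _ _) _; rewrite distrC ltW.
have phiz : phi (A *: u) - d <= phi z.
  have := phiL.2 (A *: u - z); rewrite (blinB _ _ phiL) mul1r; lra.
exists (z, m) => /=; split => //; first exact: leq_addr.
  by apply: le_trans zA _; rewrite /d; lra.
by move: zA d0 phiAu phiz; rewrite ler_norml /d; lra.
Qed.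

(* [s - phi] and [tau - psi] are the Busemann functions of a sequence z
   in S and of its image; the distances to z are compared up to multiples of r. *)
Lemma halfspaces phi (s : R) : norm_one phi -> exists psi (tau : R),
  bounded_linear 1 psi /\ forall x, S x -> forall n : int,
   (s + n%:~R * r < phi x -> tau + n%:~R * r <= psi (f x)) /\
   (phi x < s + n%:~R * r -> psi (f x) <= tau + n%:~R * r).
Proof.
move=> phi1; have [z [m zmP]] := halfspaces_seq s phi1.
have [phiL _] := phi1; have [fS gS fK gK fr] := fg.
have [F [FU Foo]] := ultraFilterLemma (F := \oo) _.
have FF : ProperFilter F := @ultra_proper _ _ FU.
have harm0 : (harmonic j : R) @[j --> F] --> (0 : R).
  by move=> V /(@cvg_harmonic R)/Foo.
have harm1 j : (harmonic j : R) <= 1 by rewrite /harmonic /= invf_le1 ?ltr0n // ler1n.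
have zinf (M : R) : \forall j \near F, M <= `|z j|.
  have [n nP] := exists_nat_ge ((M + 1 + `|s|) / r).
  apply: Foo; exists n => // j /= nj; have [_ jm + _] := zmP j.
  rewrite ler_pdivrMr // in nP.
  have mr : n%:R * r <= (m j)%:R * r by rewrite ler_pM2r // ler_nat (leq_trans nj).
  have := harm1 j; have := ler_norm (- s); rewrite normrN ler_norml; lra.
have zm j : `| `|z j| - (m j)%:R * r| <= `|s| + 1.
  have [_ _ + _] := zmP j; have := harm1 j; have := ler_norm (- s); have := ler_norm s.
  by rewrite normrN !ler_norml; lra.
have [tau0 [phi0 [phi0L phi0P]]] := horofunction US FU zinf zm.
have tau0E : tau0 = s.
  have := phi0P 0; rewrite (blin0 phi0L) subr0 => h.
  apply: (cvg_unique (@norm_hausdorff _ R) h).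
  have c : (harmonic j + s : R) @[j --> F] --> 0 + s by apply: cvgD => //; exact: cvg_cst.
  have c' : (s - harmonic j : R) @[j --> F] --> s - 0 by apply: cvgB => //; exact: cvg_cst.
  rewrite add0r in c; rewrite subr0 in c'.
  apply: (squeeze_cvgr _ c' c); apply: nearW => j.
  by have [_ _ + _] := zmP j; rewrite subr0 ler_norml; lra.
(* From |z j - y| >= phi (z j - y) and the almost norming property, phi0 <= phi everywhere; for
   linear forms this is already equality. *)
have phi0E y : phi0 y = phi y.
  have le y' : phi0 y' <= phi y'.
    suff : s - phi y' <= tau0 - phi0 y' by rewrite tau0E; lra.
    have c : s - phi y' - 2 * harmonic j @[j --> F] --> s - phi y' - 2 * 0.
      by apply: cvgB; [exact: cvg_cst|apply: cvgMr].
    rewrite mulr0 subr0 in c.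
    apply: (limit_le c (phi0P y')); apply: nearW => j.
    have [_ _ + +] := zmP j; have := phiL.2 (z j - y').
    by rewrite (blinB _ _ phiL) mul1r ler_norml; lra.
  have := le (- y); rewrite (blinN _ phiL) (blinN _ phi0L) => h.
  by have := le y; lra.
have [x0 Sx0 _] := (dense_normP S).1 dS 0 1 ltr01.
(* Norms change by a bounded amount under [f], so the same heights (m j) r normalise the image
   sequence. *)
have fz j : `| `|f (z j)| - `|z j| | <= r + `|x0| + `|f x0|.
  have [Szj _ _ _] := zmP j.
  have := step_dist2 dS r0 fg Szj Sx0.
  have := ler_dist_dist (f (z j) - f x0) (f (z j)).
  have := ler_dist_dist (z j - x0) (z j).
  rewrite [z j - x0 - z j]addrAC [f _ - _ - f _]addrAC !subrr !sub0r !normrN.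
  by rewrite !ler_norml; lra.
have fzinf (M : R) : \forall j \near F, M <= `|f (z j)|.
  apply: filterS (zinf (M + (r + `|x0| + `|f x0|))) => j.
  by have := fz j; rewrite ler_norml; lra.
have fzm j : `| `|f (z j)| - (m j)%:R * r| <= `|s| + 1 + (r + `|x0| + `|f x0|).
  by have := fz j; have := zm j; rewrite !ler_norml; lra.
have [tau [psi [psiL psiP]]] := horofunction US FU fzinf fzm.
exists psi, tau; split=> // x Sx n.
have cx : `|z j - x| - (m j)%:R * r @[j --> F] --> s - phi x.
  by rewrite -tau0E -phi0E; exact: phi0P.
have mn j : ((m j)%:Z - n)%:~R * r = (m j)%:R * r - n%:~R * r :> R.
  by rewrite intrD mulrDl mulrNz mulNr.
(* In both halves a strict inequality between limits holds for F-almost all j, where it compares |z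
   j - x| with an integral multiple of r. The first half transports it by [f], the second by [g]. *)
split=> hx.
  suff : tau - psi (f x) <= - (n%:~R * r) by lra.
  apply: (cvgr_to_le (psiP (f x))).
  have hlt : s - phi x < - (n%:~R * r) by lra.
  have : \forall j \near F, `|z j - x| - (m j)%:R * r < - (n%:~R * r).
    exact: (cvgr_lt _ cx).
  apply: filterS => j hj; have [Szj _ _ _] := zmP j.
  have /(step_int dS r0 fg Szj Sx) : `|z j - x| < ((m j)%:Z - n)%:~R * r by rewrite mn; lra.
  by rewrite mn; lra.
suff : - (n%:~R * r) <= tau - psi (f x) by lra.
apply: (cvgr_to_ge (psiP (f x))).
have hlt : - (n%:~R * r) < s - phi x by lra.
have : \forall j \near F, - (n%:~R * r) < `|z j - x| - (m j)%:R * r.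
  exact: (cvgr_gt _ cx).
apply: filterS => j hj; have [Szj _ _ _] := zmP j.
rewrite leNgt; apply/negP => hlt2.
have : `|f (z j) - f x| < ((m j)%:Z - n)%:~R * r by rewrite mn; lra.
move/(step_int dS r0 (step_pair_sym fg) (fS _ Szj) (fS _ Sx)).
by rewrite !fK // mn; lra.
Qed.

End halfspaces.

(** * Companion functionals, from bounded error to exact equality *)

Section coarse_duality.
Variables (R : realType) (X : normedModType R) (S : set X) (r : R) (f g : X -> X).
Hypotheses (US : uniformly_smooth X) (dS : dense S) (r0 : 0 < r) (fg : step_pair S r f g).
Implicit Types (phi psi : X -> R).

Definition coarse_dual phi psi :=
  [/\ exists C, bounded_linear C phi, exists C, bounded_linear C psi
    & exists K, forall x, S x -> `|psi (f x) - phi x| <= K].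

(** Boundedness spreads from S to X, every vector being within 1 of S; then all multiples n x are
    controlled by one constant. *)
Lemma bounded_on_dense_eq0 C K phi : bounded_linear C phi ->
  (forall x, S x -> `|phi x| <= K) -> forall x, phi x = 0.
Proof.
move=> phiL phiK x; have all y : `|phi y| <= K + `|C|.
  have [s Ss ys] := (dense_normP S).1 dS y 1 ltr01.
  have -> : phi y = phi s + phi (y - s) by rewrite (blinB _ _ phiL) addrC subrK.
  apply: le_trans (ler_normD _ _) _; apply: lerD; first exact: phiK.
  apply: le_trans (blin_norm _ phiL) _.
  apply: le_trans (_ : `|C| * `|y - s| <= _); first by rewrite ler_wpM2r // ler_norm.
  by rewrite -[leRHS]mulr1 ler_wpM2l // ltW.
apply: contrapT => /eqP; rewrite -normr_gt0 => x0.
have [n nP] := exists_nat_ge ((K + `|C| + 1) / `|phi x|).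
have := all (n%:R *: x); rewrite (blinZ _ _ phiL) normrM (ger0_norm (ler0n _ n)).
by move: nP; rewrite ler_pdivrMr //; lra.
Qed.

(** The difference psi - psi' is bounded on f(S), which is S because [g] inverts [f] there. *)
Lemma coarse_dual_unique phi psi psi' :
  coarse_dual phi psi -> coarse_dual phi psi' -> forall x, psi x = psi' x.
Proof.
move=> [_ [C psiL] [K psiK]] [_ [C' psiL'] [K' psiK']] x.
have [fS gS fK gK _] := fg.
have L := blin_comb (-1) psiL' psiL.
apply/eqP; rewrite -subr_eq0; apply/eqP.
have -> : psi x - psi' x = -1 * psi' x + psi x by ring.
apply: (bounded_on_dense_eq0 L (K := K + K')) => y Sy.
rewrite -(gK y Sy); have := psiK _ (gS _ Sy); have := psiK' _ (gS _ Sy).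
rewrite !ler_norml; lra.
Qed.

Lemma coarse_dual_comb (a : R) phi psi phi' psi' :
  coarse_dual phi psi -> coarse_dual phi' psi' ->
  coarse_dual (fun x => a * phi x + phi' x) (fun x => a * psi x + psi' x).
Proof.
move=> [[A hA] [B hB] [K hK]] [[A' hA'] [B' hB'] [K' hK']]; split.
- by eexists; exact: blin_comb hA hA'.
- by eexists; exact: blin_comb hB hB'.
exists (`|a| * K + K') => x Sx.
have -> : a * psi (f x) + psi' (f x) - (a * phi x + phi' x) =
  a * (psi (f x) - phi x) + (psi' (f x) - phi' x) by ring.
apply: le_trans (ler_normD _ _) _; apply: lerD; last exact: hK'.
by rewrite normrM ler_wpM2l // hK.
Qed.

Lemma halfspaces_coarse phi psi (s tau : R) : bounded_linear 1 phi -> bounded_linear 1 psi ->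
  (forall x, S x -> forall n : int,
   (s + n%:~R * r < phi x -> tau + n%:~R * r <= psi (f x)) /\
   (phi x < s + n%:~R * r -> psi (f x) <= tau + n%:~R * r)) -> coarse_dual phi psi.
Proof.
move=> phiL psiL H; split; [by exists 1|by exists 1|].
exists (`|tau - s| + 2 * r) => x Sx.
pose n := Num.floor ((phi x - s) / r).
(* The thresholds used below are n - 1 and n + 1: phi x may equal s + n r, and only strict
   inequalities transfer. Hence the error 2 r. *)
have n1 : n%:~R * r <= phi x - s by rewrite -ler_pdivlMr // Num.Theory.floor_le_tmp.
have n2 : phi x - s < (n + 1)%:~R * r by rewrite -ltr_pdivrMr // Num.Theory.floorD1_gt.
have [h1 _] := H x Sx (n - 1); have [_ h2] := H x Sx (n + 1).
rewrite intrD mulrDl mulr1z mul1r in n2 h2.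
rewrite intrD mulrDl mulrN1z mulN1r in h1.
have h1' := h1 ltac:(lra); have h2' := h2 ltac:(lra).
have := ler_norm (tau - s); have := ler_norm (- (tau - s)); rewrite normrN ler_norml.
lra.
Qed.

(** For monotonicity, the offset s is taken midway between phi x and phi y, so that one hyperplane
    separates the two points; the functional obtained from this s is psi again, by uniqueness. *)
Lemma coarse_dual_norm_one phi : norm_one phi -> exists psi,
  [/\ bounded_linear 1 psi, coarse_dual phi psi &
     forall x y, S x -> S y -> phi x < phi y -> psi (f x) <= psi (f y)].
Proof.
move=> phi1; have phiL := phi1.1.
have [psi [tau [psiL H]]] := halfspaces US dS r0 fg 0 phi1.
have cd := halfspaces_coarse phiL psiL H.
exists psi; split=> // x y Sx Sy xy.
have [psi' [tau' [psiL' H']]] := halfspaces US dS r0 fg ((phi x + phi y) / 2) phi1.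
have E := coarse_dual_unique cd (halfspaces_coarse phiL psiL' H').
have [_ hx] := H' x Sx 0; have [hy _] := H' y Sy 0.
rewrite !E; apply: le_trans (hx _) (hy _); rewrite mul0r addr0; lra.
Qed.

(** A nonzero phi is divided by its actual norm N, which is at most C. Keeping the same bound C for
    psi is what later makes [f] nonexpansive. *)
Lemma coarse_dual_total phi C : bounded_linear C phi -> exists psi,
  [/\ bounded_linear C psi, coarse_dual phi psi &
     forall x y, S x -> S y -> phi x < phi y -> psi (f x) <= psi (f y)].
Proof.
move=> phiL.
have [phi0|/existsNP[v phiv]] := pselect (forall x, phi x = 0).
  exists phi; split=> //; last by move=> x y _ _; rewrite !phi0 ltxx.
  split; [by exists C|by exists C|].
  by exists 0 => x _; rewrite !phi0 subrr normr0.
pose E := [set phi u | u in [set u : X | `|u| = 1]].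
have phi_scale x : x != 0 -> E (phi x / `|x|).
  move=> x0; exists (`|x|^-1 *: x); last by rewrite (blinZ _ _ phiL) mulrC.
  by rewrite /= normrZ normfV normr_id mulVf // normr_eq0.
have v0 : v != 0 by apply/eqP => v0; apply: phiv; rewrite v0 (blin0 phiL).
have supE : has_sup E.
  split; first by exists (phi v / `|v|); exact: phi_scale.
  by exists C => _ [u /= u1 <-]; have := phiL.2 u; rewrite u1 mulr1.
pose N := sup E.
have phiN x : phi x <= N * `|x|.
  have [->|x0] := eqVneq x 0; first by rewrite (blin0 phiL) normr0 mulr0.
  rewrite -ler_pdivrMr ?normr_gt0 //; apply: sup_upper_bound => //.
  exact: phi_scale.
have phiLN : bounded_linear N phi by split; [exact: phiL.1|].
have N0 : 0 < N.
  have : 0 < N * `|v| by apply: lt_le_trans (blin_norm v phiLN); rewrite normr_gt0; apply/eqP.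
  by rewrite pmulr_lgt0 // normr_gt0.
have NC : N <= C.
  by apply: ge_sup; [exact: supE.1|move=> _ [u /= u1 <-]; have := phiL.2 u; rewrite u1 mulr1].
have one : norm_one (fun x => N^-1 * phi x).
  split; first by have := blin_scale N^-1 phiLN; rewrite ger0_norm ?invr_ge0 ?(ltW N0) // mulVf // gt_eqF.
  move=> e e0; have [_ [u /= u1 <-] hu] := sup_adherent (mulr_gt0 e0 N0) supE.
  exists u => //; rewrite -(ler_pM2l N0) mulrA mulfV ?gt_eqF // mul1r.
  by rewrite -/N in hu; move/ltW: hu; apply: le_trans; rewrite le_eqVlt; apply/orP; left; apply/eqP; ring.
have [psi [psiL cd mono]] := coarse_dual_norm_one one.
exists (fun x => N * psi x); split.
- have h := blin_scale N psiL; split; first exact: h.1.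
  move=> x; apply: le_trans (h.2 x) _; rewrite mulr1 ger0_norm ?(ltW N0) //.
  by rewrite ler_wpM2r.
- have z : coarse_dual (fun _ => 0) (fun _ => 0).
    have b0 : @bounded_linear R X 0 (fun _ => 0).
      by split=> [a x y|x]; rewrite ?mulr0 ?addr0 // mul0r.
    by split; [exists 0|exists 0|exists 0 => x _; rewrite subr0 normr0].
  have := coarse_dual_comb N cd z.
  have -> : (fun x => N * (N^-1 * phi x) + 0) = phi.
    by apply/funext => x; rewrite addr0 mulrA mulfV ?mul1r // gt_eqF.
  by have -> : (fun x => N * psi x + 0) = (fun x => N * psi x) by apply/funext => x; rewrite addr0.
move=> x y Sx Sy xy; rewrite ler_pM2l //; apply: mono => //.
by rewrite ltr_pM2l // invr_gt0.
Qed.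

Lemma coarse_dual_mono phi psi : coarse_dual phi psi ->
  forall x y, S x -> S y -> 0 < phi (x - y) -> 0 <= psi (f x - f y).
Proof.
move=> cd x y Sx Sy; have [[C phiL] [D psiL] _] := cd.
have [psi' [_ cd' mono]] := coarse_dual_total phiL.
have E := coarse_dual_unique cd cd'.
rewrite (blinB _ _ phiL) (blinB _ _ psiL) !subr_ge0 subr_gt0 => h.
by rewrite !E; apply: mono.
Qed.

(* [phi |-> psi (f x - f y)] is a linear form which is nonnegative wherever
   [phi (x - y)] is positive. *)
Lemma coarse_dual_ratio x y : S x -> S y -> x != y -> exists c : R,
  forall phi psi, coarse_dual phi psi -> psi (f x - f y) = c * phi (x - y).
Proof.
move=> Sx Sy xy; have D0 : 0 < `|x - y| by rewrite normr_gt0 subr_eq0.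
have [phi0 phi0L phi0D] := norming US (x - y).
have [psi0 [_ cd0 _]] := coarse_dual_total phi0L.
have ker phi psi : coarse_dual phi psi -> phi (x - y) = 0 -> 0 <= psi (f x - f y).
  move=> cd z; apply/ler_addgt0Pr => e e0.
  (* Adding k phi0 makes a functional vanishing at x - y positive there; this k keeps the
     contribution of psi0 below e. *)
  pose k := e / (`|psi0 (f x - f y)| + 1).
  have k0 : 0 < k by rewrite divr_gt0 // ltr_wpDl.
  have := coarse_dual_mono (coarse_dual_comb k cd0 cd) Sx Sy.
  rewrite z phi0D addr0 => /(_ (mulr_gt0 k0 D0)) h.
  have : k * psi0 (f x - f y) <= e.
    apply: le_trans (_ : k * (`|psi0 (f x - f y)| + 1) <= _).
      by rewrite ler_wpM2l ?(ltW k0) // (le_trans (ler_norm _)) // lerDl.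
    by rewrite /k divfK // gt_eqF // ltr_wpDl.
  by lra.
exists (psi0 (f x - f y) / `|x - y|) => phi psi cd.
pose t := phi (x - y) / `|x - y|.
have cdt := coarse_dual_comb (- t) cd0 cd.
have z : - t * phi0 (x - y) + phi (x - y) = 0.
  by rewrite phi0D /t; field; rewrite gt_eqF.
have h1 := ker _ _ cdt z.
(* The combination -2 u + u is -u: the opposite pair yields the reverse inequality. *)
have cdt' := coarse_dual_comb (-2) cdt cdt.
have h2 := ker _ _ cdt' ltac:(by rewrite /= z mulr0 addr0).
rewrite /t in h1 h2.
have E : psi0 (f x - f y) / `|x - y| * phi (x - y) =
  phi (x - y) / `|x - y| * psi0 (f x - f y) by field; rewrite gt_eqF.
by rewrite E; lra.
Qed.

Hypothesis nc : forall x : X, exists y, forall t : R, y <> t *: x.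

(** z approximates y - m (x - y) - u, where u is a vector off the line of x - y, projected into the
    kernel of phi0. The form chi is a functional norming u, corrected by a multiple of phi0 so as to
    vanish at x - y. *)
Lemma third_point x y (M : R) phi0 : x != y -> bounded_linear 1 phi0 ->
  phi0 (x - y) = `|x - y| -> exists z chi C, [/\ S z, bounded_linear C chi,
     chi (x - y) = 0, chi (y - z) != 0 & M <= phi0 (y - z)].
Proof.
move=> xy phi0L phi0D; have D0 : 0 < `|x - y| by rewrite normr_gt0 subr_eq0.
have [v vP] := nc (x - y).
pose u := v - (phi0 v / `|x - y|) *: (x - y).
have u0 : u != 0 by rewrite subr_eq0; apply/eqP/vP.
have phiu : phi0 u = 0.
  by rewrite (blinB _ _ phi0L) (blinZ _ _ phi0L) phi0D; field; rewrite gt_eqF.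
have [phi1 phi1L phi1u] := norming US u.
pose a := phi1 (x - y) / `|x - y|.
have chiL := blin_comb (- a) phi0L phi1L.
set chi := (fun x => _) in chiL; set C := (_ + _) in chiL.
have chiD : chi (x - y) = 0 by rewrite /chi phi0D /a; field; rewrite gt_eqF.
have chiu : chi u = `|u| by rewrite /chi phiu mulr0 add0r.
have un : 0 < `|u| by rewrite normr_gt0.
pose m := (`|M| + 1) / `|x - y|.
pose p := y - (m *: (x - y) + u).
have C0 : 0 <= C by rewrite /C mulr1 addr_ge0.
(* Moving p to z within this radius changes chi by at most |u| / 2, which keeps it nonzero, and phi0
   by at most 1, which the + 1 in [m] absorbs. *)
pose e := Num.min 1 (`|u| / (C + 1) / 2).
have C1 : 0 < C + 1 by rewrite ltr_wpDl.
have e0 : 0 < e by rewrite lt_min ltr01 !divr_gt0.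
have [z Sz pz] := (dense_normP S).1 dS p e e0.
have yz : y - z = (m *: (x - y) + u) + (p - z).
  by rewrite /p addrA [_ + (y - _)]addrC subrK.
exists z, chi, C; split=> //.
  rewrite yz (blinD _ (p - z) chiL) (blinD _ u chiL) (blinZ _ _ chiL) chiD mulr0 add0r chiu.
  rewrite gt_eqF //.
  have h := blin_norm (p - z) chiL; rewrite -/C in h.
  have : C * `|p - z| <= `|u| / 2.
    apply: le_trans (_ : (C + 1) * e <= _).
      by rewrite ler_pM // ?(ltW pz) // lerDl.
    apply: le_trans (_ : (C + 1) * (`|u| / (C + 1) / 2) <= _).
      by rewrite ler_pM2l // ge_min lexx orbT.
    by rewrite le_eqVlt; apply/orP; left; apply/eqP; field; rewrite gt_eqF.
  by move: h; rewrite ler_norml; lra.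
rewrite yz (blinD _ (p - z) phi0L) (blinD _ u phi0L) (blinZ _ _ phi0L) phi0D phiu addr0.
have -> : m * `|x - y| = `|M| + 1 by rewrite /m divfK // gt_eqF.
have := blin_norm (p - z) phi0L; rewrite mul1r ler_norml.
have e1 : e <= 1 by rewrite ge_min lexx.
by have := ler_norm M; lra.
Qed.

(* A third point off the line xy shows that the ratio c does not depend on the
   pair; moving it to infinity gives c = 1 since [psi \o f - phi] is bounded. *)
Lemma coarse_dual_exact phi psi : coarse_dual phi psi ->
  forall x y, S x -> S y -> psi (f x - f y) = phi (x - y).
Proof.
move=> cd x y Sx Sy.
have [->|xy] := eqVneq x y.
  by have [[C phiL] [D psiL] _] := cd; rewrite !subrr (blin0 phiL) (blin0 psiL).
have [c cP] := coarse_dual_ratio Sx Sy xy.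
suff -> : psi (f x - f y) = 1 * phi (x - y) by rewrite mul1r.
rewrite (cP _ _ cd); congr (_ * _).
have D0 : 0 < `|x - y| by rewrite normr_gt0 subr_eq0.
have [phi0 phi0L phi0D] := norming US (x - y).
have [psi0 [psi0L cd0 _]] := coarse_dual_total phi0L.
have [_ _ [K hK]] := cd0.
have main (M : R) : 0 < M -> `|c - 1| * M <= 2 * K.
  move=> M0; have [z [chi [C [Sz chiL chiD chiyz Mz]]]] := third_point M xy phi0L phi0D.
  have [psic [psicL cdc _]] := coarse_dual_total chiL.
  have yz : y != z.
    by apply/eqP => yz; move: chiyz; rewrite yz subrr (blin0 chiL) eqxx.
  have xz : x != z.
    apply/eqP => xz; move: chiyz; rewrite -xz -opprB (blinN _ chiL) chiD oppr0.
    by rewrite eqxx.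
  have [c1 c1P] := coarse_dual_ratio Sy Sz yz.
  have [c2 c2P] := coarse_dual_ratio Sx Sz xz.
  have split3 a b d : a - d = (a - b) + (b - d) :> X by rewrite addrA subrK.
  have eq3 phi' psi' : coarse_dual phi' psi' ->
      c2 * (phi' (x - y) + phi' (y - z)) = c * phi' (x - y) + c1 * phi' (y - z).
    move=> cd'; have [[A hA] [B hB] _] := cd'.
    rewrite -(cP _ _ cd') -(c1P _ _ cd') -(blinD _ _ hA) -(blinD _ _ hB).
    by rewrite -!split3 (c2P _ _ cd').
  (* chi does not see x - y, so it identifies the ratios of xz and yz; phi0, which is nonzero at x -
     y, then identifies them with c. *)
  have e1 := eq3 _ _ cdc; rewrite chiD mulr0 !add0r in e1.
  have c12 : c2 = c1 by apply: (mulIf chiyz).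
  have e2 := eq3 _ _ cd0; rewrite c12 mulrDr phi0D in e2.
  have c1c : c1 = c by apply: (mulIf (lt0r_neq0 D0)); lra.
  have := c1P _ _ cd0; rewrite c1c (blinB _ _ psi0L) (blinB _ _ phi0L) => e3.
  have : `|(c - 1) * phi0 (y - z)| <= 2 * K.
    have hy := hK y Sy; have hz := hK z Sz.
    have -> : (c - 1) * phi0 (y - z) = (psi0 (f y) - phi0 y) - (psi0 (f z) - phi0 z).
      rewrite (blinB _ _ phi0L) mulrBl mul1r -e3; ring.
    by apply: le_trans (ler_normB _ _) _; lra.
  apply: le_trans; rewrite normrM ler_wpM2l //.
  exact: le_trans Mz (ler_norm _).
apply/eqP; rewrite -subr_eq0 -normr_eq0 eq_le normr_ge0 andbT leNgt.
apply/negP => c1.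
have K0 : 0 <= K by apply: le_trans (hK x Sx).
(* This M would give 2 K + 1 <= 2 K. *)
have := main ((2 * K + 1) / `|c - 1|) ltac:(by rewrite divr_gt0 // ltr_wpDl // mulr_ge0).
by rewrite mulrC divfK ?gt_eqF //; lra.
Qed.

Lemma dual_map C phi : bounded_linear C phi -> exists2 psi, bounded_linear C psi &
  forall x y, S x -> S y -> psi (f x - f y) = phi (x - y).
Proof.
move=> phiL; have [psi [psiL cd _]] := coarse_dual_total phiL.
by exists psi => //; exact: coarse_dual_exact.
Qed.

End coarse_duality.

(** * Extension to a linear isometry of the whole space *)

Section extension.
Variables (R : realType) (X : completeNormedModType R) (S : set X) (r : R).
Hypotheses (US : uniformly_smooth X) (dS : dense S) (r0 : 0 < r).
Hypothesis nc : forall x : X, exists y, forall t : R, y <> t *: x.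

Lemma dual_map_inv f g C (phi : X -> R) : step_pair S r f g -> bounded_linear C phi ->
  exists2 psi, bounded_linear C psi &
    forall x y, S x -> S y -> phi (f x - f y) = psi (x - y).
Proof.
move=> fg phiL; have [psi psiL psiP] := dual_map US dS r0 (step_pair_sym fg) nc phiL.
have [fS _ fK _ _] := fg; exists psi => // x y Sx Sy.
by rewrite -psiP ?fK //; exact: fS.
Qed.

(** A functional norming f x - f y is pulled back to one of norm at most 1 evaluated at x - y. *)
Lemma step_nonexpansive f g x y : step_pair S r f g -> S x -> S y ->
  `|f x - f y| <= `|x - y|.
Proof.
move=> fg Sx Sy; have [phi phiL phiE] := norming US (f x - f y).
have [psi psiL psiP] := dual_map_inv fg phiL.
by rewrite -phiE psiP //; have := psiL.2 (x - y); rewrite mul1r.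
Qed.

(** The images of points of S converging to x form a Cauchy sequence, which converges by
    completeness. The inequality records at once that [F] extends [f] and that it is
    nonexpansive. *)
Lemma step_extension f g : step_pair S r f g ->
  exists F : X -> X, forall x s, S s -> `|F x - f s| <= `|x - s|.
Proof.
move=> fg; suff h x : exists l, forall s, S s -> `|l - f s| <= `|x - s|.
  by have [F FP] := choice h; exists F.
have [u uP] : exists u : nat -> X, forall n, S (u n) /\ `|x - u n| <= (harmonic n : R).
  have h n : exists s, S s /\ `|x - s| <= (harmonic n : R).
    have [s Ss xs] := (dense_normP S).1 dS x _ (@harmonic_gt0 R n).
    by exists s; split=> //; exact: ltW.
  by have [u uP] := choice h; exists u.
have hsmall (e : R) : 0 < e -> \forall n \near \oo, (harmonic n : R) < e.
  move=> e0; have /cvgrPdist_lt/(_ _ e0) := @cvg_harmonic R.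
  by apply: filterS => n; rewrite sub0r normrN; apply: le_lt_trans; exact: ler_norm.
have : cvgn (f \o u).
  apply/cauchy_cvgP/cauchy_exP => e e0.
  have e2 : 0 < e / 2 by rewrite divr_gt0.
  have [N _ NP] := hsmall _ e2; exists (f (u N)).
  exists N => // n /= Nn; rewrite -ball_normE /=.
  have [SN xN] := uP N; have [Sn xn] := uP n.
  apply: le_lt_trans (step_nonexpansive fg SN Sn) _.
  have -> : u N - u n = (u N - x) + (x - u n) by rewrite addrA subrK.
  apply: le_lt_trans (ler_normD _ _) _; rewrite distrC.
  by have := NP N (leqnn N); have := NP n Nn; lra.
move=> /cvg_ex[l lP]; exists l => s Ss; apply/ler_addgt0Pr => e e0.
have e2 : 0 < e / 2 by rewrite divr_gt0.
have /cvgrPdist_lt/(_ _ e2) near_l := lP.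
have [n [ln xn]] := filter_ex (filterI near_l (hsmall _ e2)).
have [Sn /le_lt_trans/(_ xn) xun] := uP n.
have {}ln : `|l - f (u n)| < e / 2 by [].
have -> : l - f s = (l - f (u n)) + (f (u n) - f s) by rewrite addrA subrK.
apply: le_trans (ler_normD _ _) _.
have : `|u n - s| <= `|x - u n| + `|x - s|.
  have -> : u n - s = (u n - x) + (x - s) by rewrite addrA subrK.
  by rewrite (distrC x (u n)); exact: ler_normD.
have := step_nonexpansive fg Sn Ss; lra.
Qed.

Lemma extension_nonexpansive (f : X -> X) F :
  (forall x s, S s -> `|F x - f s| <= `|x - s|) -> forall x y, `|F x - F y| <= `|x - y|.
Proof.
move=> FP x y; apply/ler_addgt0Pr => e e0.
have e2 : 0 < e / 2 by rewrite divr_gt0.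
have [s Ss xs] := (dense_normP S).1 dS x _ e2.
have -> : F x - F y = (F x - f s) + (f s - F y) by rewrite addrA subrK.
apply: le_trans (ler_normD _ _) _.
have h1 := FP x s Ss; have := FP y s Ss; rewrite distrC => h2.
have : `|y - s| <= `|x - y| + `|x - s|.
  have -> : y - s = (y - x) + (x - s) by rewrite addrA subrK.
  by rewrite (distrC x y); exact: ler_normD.
lra.
Qed.

Lemma extension_cancel f g F G : step_pair S r f g ->
  (forall x s, S s -> `|F x - f s| <= `|x - s|) ->
  (forall x s, S s -> `|G x - g s| <= `|x - s|) -> cancel F G.
Proof.
move=> [fS _ fK _ _] FP GP x; apply/eqP; rewrite -subr_eq0 -normr_eq0 eq_le normr_ge0 andbT.
apply/ler_addgt0Pr => e e0; rewrite add0r.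
have e2 : 0 < e / 2 by rewrite divr_gt0.
have [s Ss xs] := (dense_normP S).1 dS x _ e2.
have -> : G (F x) - x = (G (F x) - g (f s)) + (s - x) by rewrite fK // addrA subrK.
apply: le_trans (ler_normD _ _) _.
have := GP (F x) _ (fS _ Ss); have := FP x s Ss; rewrite (distrC s x); lra.
Qed.

Theorem step_pair_isometry f g : step_pair S r f g -> exists T U : X -> X,
  [/\ linear_isometry T, cancel T U, cancel U T &
      forall x y, S x -> S y -> f x - f y = T (x - y)].
Proof.
move=> fg; have gf := step_pair_sym fg.
have [F FP] := step_extension fg; have [G GP] := step_extension gf.
have FK := extension_cancel fg FP GP; have GK := extension_cancel gf GP FP.
have Fiso x y : `|F x - F y| = `|x - y|.
  apply/eqP; rewrite eq_le (extension_nonexpansive FP) /=.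
  by rewrite -{1}(FK x) -{1}(FK y); exact: extension_nonexpansive GP _ _.
have Ff s : S s -> F s = f s.
  move=> Ss; apply/eqP; rewrite -subr_eq0 -normr_eq0 eq_le normr_ge0 andbT.
  by have := FP s s Ss; rewrite subrr normr0.
have dual phi : bounded_linear 1 phi -> exists2 psi, bounded_linear 1 psi &
    forall x y, phi (F x - F y) = psi (x - y).
  move=> phiL; have [psi psiL psiP] := dual_map_inv fg phiL; exists psi => // x y.
  apply/eqP; rewrite -subr_eq0 -normr_eq0 eq_le normr_ge0 andbT.
  apply/ler_addgt0Pr => e e0; rewrite add0r.
  have e4 : 0 < e / 4 by rewrite divr_gt0.
  have [s Ss xs] := (dense_normP S).1 dS x _ e4.
  have [t St yt] := (dense_normP S).1 dS y _ e4.
  have := psiP s t Ss St; rewrite !(blinB _ _ phiL) !(blinB _ _ psiL) => E.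
  have := blin_norm (F x - f s) phiL; have := blin_norm (F y - f t) phiL.
  have := blin_norm (x - s) psiL; have := blin_norm (y - t) psiL.
  have := FP x s Ss; have := FP y t St.
  rewrite !(blinB _ _ phiL) !(blinB _ _ psiL) !mul1r !ler_norml; lra.
pose T x := F x - F 0; pose U y := G (y + F 0).
(* A functional phi norming the linearity defect pulls back through T to a linear psi, for which the
   defect is zero. *)
have Tlin (a : R) x y : T (a *: x + y) = a *: T x + T y.
  apply/eqP; rewrite -subr_eq0 -normr_eq0.
  have [phi phiL <-] := norming US (T (a *: x + y) - (a *: T x + T y)).
  have [psi psiL psiP] := dual phi phiL.
  rewrite (blinB _ _ phiL) phiL.1 /T !psiP !subr0 psiL.1 subrr.
  exact: eqxx.
exists T, U; split.
- by split=> // x; rewrite /T Fiso subr0.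
- by move=> x; rewrite /T /U subrK FK.
- by move=> y; rewrite /T /U GK addrK.
move=> x y Sx Sy; rewrite -!Ff //.
have TN : T (x - y) = T x - T y.
  by rewrite addrC -scaleN1r Tlin scaleN1r addrC.
by rewrite TN /T opprB addrA subrK.
Qed.

End extension.

(** * A subspace of l4 indexed by a half-line *)

Section quartic_sums.
Variable R : realType.
Implicit Types (a b : nat -> R) (t A B M : R).

Definition psum4 a n := \sum_(i < n) a i ^+ 4.

Lemma pow4_ge0 t : 0 <= t ^+ 4.
Proof. by rewrite -[4%N]/(2 * 2)%N exprM sqr_ge0. Qed.

Lemma ler_pow4 A B : 0 <= B -> A <= B -> 0 <= A -> A ^+ 4 <= B ^+ 4.
Proof. by move=> B0 AB A0; rewrite lerXn2r. Qed.

Lemma pow4_convex (l : R) (s t : R) : 0 <= l <= 1 ->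
  (l * s + (1 - l) * t) ^+ 4 <= l * s ^+ 4 + (1 - l) * t ^+ 4.
Proof.
have sq (u v : R) : 0 <= l <= 1 ->
    (l * u + (1 - l) * v) ^+ 2 <= l * u ^+ 2 + (1 - l) * v ^+ 2.
  move=> /andP[l0 l1].
  have -> : l * u ^+ 2 + (1 - l) * v ^+ 2 =
    (l * u + (1 - l) * v) ^+ 2 + l * (1 - l) * (u - v) ^+ 2 by ring.
  by rewrite lerDl mulr_ge0 ?sqr_ge0 // mulr_ge0 // subr_ge0.
move=> l01; rewrite -[4%N]/(2 * 2)%N !exprM.
apply: le_trans (sq (s ^+ 2) (t ^+ 2) l01).
by rewrite lerXn2r ?sq // nnegrE ?sqr_ge0 //; apply: le_trans (sq _ _ l01); rewrite sqr_ge0.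
Qed.

Lemma psum4_nd a : nondecreasing_seq (psum4 a).
Proof.
apply/nondecreasing_seqP => n; rewrite /psum4 big_ord_recr /=.
by rewrite lerDl pow4_ge0.
Qed.

Lemma psum4_ge0 a n : 0 <= psum4 a n.
Proof. by rewrite /psum4 sumr_ge0 // => i _; rewrite pow4_ge0. Qed.

Lemma psum4_term a i : a i ^+ 4 <= psum4 a i.+1.
Proof. by rewrite /psum4 big_ord_recr /= lerDr psum4_ge0. Qed.

Lemma psum4Z t a n : psum4 (t *: a) n = t ^+ 4 * psum4 a n.
Proof. by rewrite /psum4 mulr_sumr; apply: eq_bigr => i _; rewrite -exprMn. Qed.

(** Minkowski's inequality with exponent 4. For positive A and B, (a + b) / (A + B) is a convex
    combination of a / A and b / B, and t^4 is convex; the remaining cases are reached by enlarging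
    both bounds slightly. *)
Lemma psum4D_le a b A B n : 0 <= A -> 0 <= B ->
  psum4 a n <= A ^+ 4 -> psum4 b n <= B ^+ 4 -> psum4 (a + b) n <= (A + B) ^+ 4.
Proof.
move=> A0 B0 aA bB; apply/ler_addgt0Pr => e e0.
suff main (A' B' : R) : 0 < A' -> 0 < B' -> A <= A' -> B <= B' ->
    psum4 (a + b) n <= (A' + B') ^+ 4.
  have [d d0 de] : exists2 d : R, 0 < d & (A + d + (B + d)) ^+ 4 <= (A + B) ^+ 4 + e.
    set W := A + B; have W0 : 0 <= W by rewrite addr_ge0.
    (* Mean value bound: (W + 2 d)^4 - W^4 <= 2 d * 4 (W + 2)^3 for 0 <= d <= 1. *)
    pose K := 8 * (W + 2) ^+ 3.
    have K0 : 0 < K by rewrite mulr_gt0 // exprn_gt0 // ltr_wpDl.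
    exists (Num.min 1 (e / K)); first by rewrite lt_min ltr01 divr_gt0.
    set d := Num.min _ _.
    have d0 : 0 < d by rewrite lt_min ltr01 divr_gt0.
    have d1 : d <= 1 by rewrite ge_min lexx.
    have dK : d * K <= e by rewrite -ler_pdivlMr // ge_min lexx orbT.
    have -> : A + d + (B + d) = W + 2 * d by rewrite /W; ring.
    apply: le_trans (_ : W ^+ 4 + d * K <= _); last by rewrite lerD2l.
    rewrite -subr_ge0 /K.
    have -> : W ^+ 4 + d * (8 * (W + 2) ^+ 3) - (W + 2 * d) ^+ 4 =
       d * (W^+2 * (48 - 24 * d) + W * (96 - 32 * d ^+2) + (64 - 16 * d ^+3)) by ring.
    have d2 : d ^+ 2 <= 1 by rewrite exprn_ile1 // ltW.
    have d3 : d ^+ 3 <= 1 by rewrite exprn_ile1 // ltW.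
    apply: mulr_ge0; first exact: ltW.
    apply: addr_ge0; last by lra.
    by apply: addr_ge0; apply: mulr_ge0; rewrite ?sqr_ge0 //; lra.
  by apply: le_trans de; apply: main; lra.
move=> A'0 B'0 AA' BB'; set W := A' + B'.
have W0 : 0 < W by rewrite addr_gt0.
set l := A' / W.
have l01 : 0 <= l <= 1.
  by apply/andP; split; [rewrite divr_ge0 // ltW|rewrite ler_pdivrMr // mul1r lerDl ltW].
have lE : 1 - l = B' / W by rewrite /l /W; field; rewrite gt_eqF.
have term i : (a + b) i ^+ 4 <= W ^+ 4 * (l * (a i / A') ^+ 4 + (1 - l) * (b i / B') ^+ 4).
  have -> : (a + b) i = W * (l * (a i / A') + (1 - l) * (b i / B')).
    by rewrite lE /l fctE; field; rewrite !gt_eqF.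
  by rewrite exprMn ler_wpM2l ?pow4_ge0 // pow4_convex.
apply: le_trans (_ : W ^+ 4 * (l * (psum4 a n / A' ^+ 4) + (1 - l) * (psum4 b n / B' ^+ 4)) <= _).
  rewrite /psum4 !mulr_suml !mulr_sumr -big_split /= mulr_sumr.
  by apply: ler_sum => i _; apply: le_trans (term i) _; rewrite !exprMn !exprVn.
rewrite -[leRHS]mulr1 ler_wpM2l ?pow4_ge0 //.
move: l01 => /andP[l0 l1].
have h1 : psum4 a n / A' ^+ 4 <= 1.
  by rewrite ler_pdivrMr ?exprn_gt0 // mul1r (le_trans aA) // ler_pow4 // ltW.
have h2 : psum4 b n / B' ^+ 4 <= 1.
  by rewrite ler_pdivrMr ?exprn_gt0 // mul1r (le_trans bB) // ler_pow4 // ltW.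
rewrite [leRHS](_ : 1 = l * 1 + (1 - l) * 1); last by ring.
by rewrite lerD // ler_wpM2l // subr_ge0.
Qed.

(* The entries of even index are free, [a n.*2] being attached to the vertex n
   of the half-line 0 - 1 - 2 - ..., and those of odd index are attached to its
   edges. With the coefficient 1 instead of 2, exchanging [a 0] and [a 1] up to
   sign would give one more isometry. *)
Definition l4_chain a :=
  (exists M, forall n, psum4 a n <= M) /\
  (forall n, a n.*2.+1 = 2 * a n.*2 + a n.*2.+2).

Definition in_chain : pred (nat -> R) := fun a => `[< l4_chain a >].

Lemma psum4_root (M : R) : 0 <= M -> exists2 A, 0 <= A & M = A ^+ 4.
Proof.
move=> M0; exists (Num.sqrt (Num.sqrt M)); first exact: sqrtr_ge0.
by rewrite -[4%N]/(2 * 2)%N exprM !sqr_sqrtr // sqrtr_ge0.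
Qed.

Lemma l4_chain_bound a : l4_chain a -> exists2 A, 0 <= A & forall n, psum4 a n <= A ^+ 4.
Proof.
move=> [[M aM] _]; have M0 : 0 <= M by apply: le_trans (aM 0%N); exact: psum4_ge0.
by have [A A0 ME] := psum4_root M0; exists A => // n; rewrite -ME.
Qed.

Lemma in_chain_submod : submod_closed in_chain.
Proof.
split=> [|t a b].
  have z n : (0 : nat -> R) n = 0 by [].
  apply/asboolP; split; last by move=> n; rewrite !z mulr0 addr0.
  by exists 0 => n; rewrite /psum4 big1 // => i _; rewrite z expr0n.
move=> /asboolP ca /asboolP cb; apply/asboolP; split; last first.
  by move=> n; rewrite !fctE ca.2 cb.2 /GRing.scale /=; ring.
have [A A0 aA] := l4_chain_bound ca.
have [B B0 bB] := l4_chain_bound cb.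
exists ((`|t| * A + B) ^+ 4) => n; apply: psum4D_le => //.
  by rewrite mulr_ge0.
rewrite psum4Z exprMn; have -> : `|t| ^+ 4 = t ^+ 4.
  by rewrite -normrX ger0_norm // pow4_ge0.
by rewrite ler_wpM2l // pow4_ge0.
Qed.

End quartic_sums.

HB.instance Definition _ (R : realType) :=
  GRing.isSubmodClosed.Build R (nat -> R) (@in_chain R) (@in_chain_submod R).

Record chain (R : realType) := Chain { seq_of :> nat -> R; _ : in_chain seq_of }.

Section chain_inst.
Variable R : realType.
HB.instance Definition _ := [isSub of chain R for @seq_of R].
HB.instance Definition _ := [Choice of chain R by <:].
HB.instance Definition _ := [SubChoice_isSubLmodule of chain R by <:].

End chain_inst.

Section chain_norm.
Variable R : realType.
Implicit Types (a b : chain R).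

Definition chain_norm a : R := Num.sqrt (Num.sqrt (sup (range (psum4 a)))).

Lemma chainP a : l4_chain a.
Proof. by case: a => a /= /asboolP. Qed.

Lemma chain_norm_ge0 a : 0 <= chain_norm a.
Proof. exact: sqrtr_ge0. Qed.

Lemma has_sup_psum4 a : has_sup (range (psum4 a)).
Proof.
have [[M aM] _] := chainP a.
by split; [exists (psum4 a 0), 0%N|exists M => _ [n _ <-]].
Qed.

Lemma chain_norm4 a : chain_norm a ^+ 4 = sup (range (psum4 a)).
Proof.
rewrite /chain_norm -[4%N]/(2 * 2)%N exprM !sqr_sqrtr // ?sqrtr_ge0 //.
apply: le_trans (psum4_ge0 a 0) _; apply: sup_upper_bound; first exact: has_sup_psum4.
by exists 0%N.
Qed.

Lemma psum4_le_norm a n : psum4 a n <= chain_norm a ^+ 4.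
Proof.
by rewrite chain_norm4; apply: sup_upper_bound; [exact: has_sup_psum4|exists n].
Qed.

Lemma chain_norm_le a M : 0 <= M -> (forall n, psum4 a n <= M ^+ 4) -> chain_norm a <= M.
Proof.
move=> M0 aM; rewrite -(@ler_pXn2r _ 4) ?nnegrE ?chain_norm_ge0 //.
rewrite chain_norm4; apply: ge_sup; first by exists (psum4 a 0), 0%N.
by move=> _ [n _ <-].
Qed.

Lemma chain_normD a b : chain_norm (a + b) <= chain_norm a + chain_norm b.
Proof.
apply: chain_norm_le => [|n]; first by rewrite addr_ge0 ?chain_norm_ge0.
by apply: psum4D_le; rewrite ?chain_norm_ge0 ?psum4_le_norm.
Qed.

Lemma chain_normZ_le (t : R) a : chain_norm (t *: a) <= `|t| * chain_norm a.
Proof.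
apply: chain_norm_le => [|n]; first by rewrite mulr_ge0 ?chain_norm_ge0.
have -> : seq_of (t *: a) = t *: (a : nat -> R) by [].
rewrite psum4Z exprMn; have -> : `|t| ^+ 4 = t ^+ 4.
  by rewrite -normrX ger0_norm // pow4_ge0.
by rewrite ler_wpM2l ?pow4_ge0 // psum4_le_norm.
Qed.

Lemma chain_normZ (t : R) a : chain_norm (t *: a) = `|t| * chain_norm a.
Proof.
apply/eqP; rewrite eq_le chain_normZ_le /=.
have [->|t0] := eqVneq t 0.
  by rewrite normr0 mul0r chain_norm_ge0.
rewrite -{1}[a](scalerK t0) -ler_pdivlMl ?normr_gt0 //.
by rewrite -normfV chain_normZ_le.
Qed.

Lemma coord_le_norm a i : `|a i| <= chain_norm a.
Proof.
rewrite -(@ler_pXn2r _ 4) ?nnegrE ?chain_norm_ge0 //.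
rewrite -normrX ger0_norm ?pow4_ge0 //.
exact: le_trans (psum4_term a i) (psum4_le_norm a _).
Qed.

Lemma chain_norm0_eq0 a : chain_norm a = 0 -> a = 0.
Proof.
move=> a0; apply/val_inj/funext => i /=; apply/eqP.
by rewrite -normr_eq0 eq_le normr_ge0 andbT -a0 coord_le_norm.
Qed.

HB.instance Definition _ :=
  Lmodule_isNormed.Build R (chain R) chain_normD chain_normZ chain_norm0_eq0.

Lemma chain_normE a : `|a| = chain_norm a.
Proof. by []. Qed.

Lemma psum4_cvg T (F : set_system T) {FF : Filter F} (u : T -> nat -> R) (l : nat -> R) n :
  (forall i, u t i @[t --> F] --> l i) -> psum4 (u t) n @[t --> F] --> psum4 l n.
Proof.
move=> ul; elim: n => [|n IHn].
  by under eq_cvg do rewrite /psum4 big_ord0; rewrite /psum4 big_ord0; exact: cvg_cst.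
under eq_cvg do rewrite /psum4 big_ord_recr /=.
rewrite /psum4 big_ord_recr /=; apply: cvgD => //.
have pow4 (x : R) : x ^+ 4 = (x * x) * (x * x) by ring.
under eq_cvg do rewrite pow4.
by rewrite pow4; do 2?apply: cvgM.
Qed.

(** Coordinates converge since each is bounded by the norm. The Cauchy estimate passes to the limit
    in every finite partial sum, and the linear relations between entries survive pointwise
    limits. *)
Lemma chain_complete (F : set_system (chain R)) : ProperFilter F -> cauchy F -> cvg F.
Proof.
move=> FF /cauchy_ballP Fc.
have coord i : exists l : R, seq_of a i @[a --> F] --> l.
  apply/cvg_ex/cauchy_cvgP/cauchy_ballP => e e0; near_simpl.
  move: (Fc e e0); rewrite !near_simpl => -[[A B]] /= [FA FB] AB.
  exists (A, B) => // -[a b] /= [Aa Bb]; have := AB (a, b) (conj Aa Bb).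
  rewrite -!ball_normE /= => ab; apply: le_lt_trans ab.
  exact: (coord_le_norm (a - b)).
have [l lP] := choice coord.
have bound e : 0 < e -> \forall b \near F, forall n, psum4 (seq_of b - l) n <= e ^+ 4.
  move=> e0; have := Fc e e0; rewrite near_simpl => -[[A B]] /= [FA FB] AB.
  apply: filterS FA => b Ab n.
  have cb : psum4 (seq_of b - seq_of c) n @[c --> F] --> psum4 (seq_of b - l) n.
    by apply: psum4_cvg => i; apply: cvgB => //; exact: cvg_cst.
  apply: (cvgr_to_le cb); apply: filterS FB => c Bc.
  have := AB (b, c) (conj Ab Bc); rewrite -ball_normE /= => bc.
  apply: le_trans (psum4_le_norm (b - c) n) _.
  by apply: ler_pow4; [exact: ltW|exact: ltW|exact: chain_norm_ge0].
have lc : l4_chain l.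
  split.
    have /filter_ex[b bl] := bound 1 ltr01.
    exists ((1 + chain_norm b) ^+ 4) => n.
    have -> : l = (- 1 : R) *: (seq_of b - l) + seq_of b.
      by rewrite scaleN1r opprB subrK.
    apply: psum4D_le; rewrite ?ler01 ?chain_norm_ge0 ?psum4_le_norm //.
    by rewrite psum4Z -signr_odd expr0 mul1r bl.
  move=> n; have ll := lP n.*2.+1.
  have lr : (2 * seq_of a n.*2 + seq_of a n.*2.+2) @[a --> F] --> 2 * l n.*2 + l n.*2.+2.
    by apply: cvgD => //; apply: cvgM => //; exact: cvg_cst.
  apply: (cvg_unique (@norm_hausdorff _ R) ll); apply: cvg_trans lr.
  by apply: near_eq_cvg; apply: nearW => a; rewrite (chainP a).2.
apply/cvg_ex; exists (Chain (asboolT lc)).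
apply/cvgrPdist_le => e e0.
apply: filterS (bound e e0) => b bl; rewrite distrC chain_normE.
by apply: chain_norm_le => [|n]; [exact: ltW|exact: bl].
Qed.

HB.instance Definition _ := Uniform_isComplete.Build (chain R) chain_complete.

End chain_norm.

Lemma cvgn_unique (R : realType) (u : nat -> R) (l l' : R) :
  u n @[n --> \oo] --> l -> u n @[n --> \oo] --> l' -> l = l'.
Proof. by move=> ul ul'; exact: (cvg_unique (@norm_hausdorff _ R) ul ul'). Qed.

(** * Smoothness and disjointness of supports *)

Section chain_geometry.
Variable R : realType.
Implicit Types (a b x y : chain R).

Lemma psum4_cvg_norm a : psum4 a n @[n --> \oo] --> `|a| ^+ 4.
Proof.
rewrite chain_normE chain_norm4; apply: nondecreasing_cvgn; first exact: psum4_nd.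
by exists (`|a| ^+ 4) => _ [n _ <-]; exact: psum4_le_norm.
Qed.

Lemma norm4_fin a n : (forall i, (n <= i)%N -> a i = 0) -> `|a| ^+ 4 = psum4 a n.
Proof.
move=> an; apply: (cvgn_unique (@psum4_cvg_norm a)).
apply: cvg_near_cst; exists n => // m /= nm; rewrite -(subnKC nm).
rewrite /psum4 big_split_ord /= [X in _ + X]big1 ?addr0 // => i _.
by rewrite an ?leq_addr // expr0n.
Qed.

Lemma sum4_cvg a b :
  psum4 (seq_of (a + b)) n + psum4 (seq_of (a - b)) n @[n --> \oo] --> `|a + b| ^+ 4 + `|a - b| ^+ 4.
Proof. by apply: cvgD; exact: psum4_cvg_norm. Qed.

(** The cross term is a sum of squares. It vanishes exactly on disjoint supports, and for fixed b it
    grows only like |a|^2, which is what smoothness needs. *)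
Lemma psum4DB a b n : psum4 (seq_of (a + b)) n + psum4 (seq_of (a - b)) n =
  2 * psum4 a n + 2 * psum4 b n + 12 * \sum_(i < n) (a i * b i) ^+ 2.
Proof.
rewrite /psum4 !mulr_sumr -!big_split /=; apply: eq_bigr => i _.
by rewrite -[LHS]/((a i + b i) ^+ 4 + (a i - b i) ^+ 4); ring.
Qed.

(** With W = |w|, the cross term is at most 6 W^2 K by the arithmetic-geometric inequality. The
    power mean inequality then bounds the fourth power of (|w + y| + |w - y|) / 2 by W^4 + 4 K W^2,
    hence by W^4 + 2 e W^3 once 2 K <= e W, and this is at most (W + e/2)^4. *)
Lemma chain_uniformly_smooth : @uniformly_smooth R (chain R).
Proof.
move=> y e e0; pose K := 1 + `|y| ^+ 4.
have K1 : 1 <= K by rewrite lerDl pow4_ge0.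
exists (1 + 2 * K / e) => w Mw; set W := `|w|.
have W1 : 1 <= W by apply: le_trans Mw; rewrite lerDl divr_ge0 // ?ltW // mulr_gt0 // (lt_le_trans ltr01).
have W0 : 0 < W by apply: lt_le_trans W1.
have KW : 2 * K <= e * W.
  by rewrite [leRHS]mulrC -ler_pdivrMr //; apply: le_trans Mw; rewrite lerDr ler01.
have key : `|w + y| ^+ 4 + `|w - y| ^+ 4 <= 2 * W ^+ 4 + 6 * W ^+ 2 * K + 2 * `|y| ^+ 4.
  apply: (cvgr_to_le (@sum4_cvg w y)); apply: nearW => n.
  rewrite psum4DB.
  have cross : 12 * \sum_(i < n) (w i * y i) ^+ 2 <=
      6 * (psum4 w n / W ^+ 2 + psum4 y n * W ^+ 2).
    rewrite /psum4 !mulr_suml -big_split /= !mulr_sumr; apply: ler_sum => i _.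
    rewrite -subr_ge0.
    have -> : 6 * (w i ^+ 4 / W ^+ 2 + y i ^+ 4 * W ^+ 2) - 12 * (w i * y i) ^+ 2 =
      6 * (w i ^+ 2 / W - y i ^+ 2 * W) ^+ 2 by field; rewrite gt_eqF.
    by rewrite mulr_ge0 // sqr_ge0.
  have wn := psum4_le_norm w n; rewrite -chain_normE -/W in wn.
  have yn := psum4_le_norm y n; rewrite -chain_normE in yn.
  have h1 : psum4 w n / W ^+ 2 <= W ^+ 2.
    by rewrite ler_pdivrMr ?exprn_gt0 // -exprD.
  have h2 : psum4 y n * W ^+ 2 <= `|y| ^+ 4 * W ^+ 2 by rewrite ler_wpM2r ?sqr_ge0.
  apply: le_trans (_ : 2 * W ^+ 4 + 2 * `|y| ^+ 4 + 6 * (W ^+ 2 + `|y| ^+ 4 * W ^+ 2) <= _).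
    by apply: lerD; [lra|apply: le_trans cross _; lra].
  by rewrite /K le_eqVlt; apply/orP; left; apply/eqP; ring.
set A := `|w + y| in key *; set B := `|w - y| in key *.
have A0 : 0 <= A by rewrite /A.
have B0 : 0 <= B by rewrite /B.
have mid : ((A + B) / 2) ^+ 4 <= (A ^+ 4 + B ^+ 4) / 2.
  have := @pow4_convex R (1/2) A B; have -> : 1 - 1/2 = 1/2 :> R by field.
  have -> : 1 / 2 * A + 1 / 2 * B = (A + B) / 2 by field.
  by move=> h; have := h ltac:(lra); lra.
have fin : (A + B) / 2 <= W + e / 2.
  rewrite -(@ler_pXn2r _ 4) ?nnegrE ?divr_ge0 ?addr_ge0 //; [|lra..].
  apply: le_trans mid _.
  have -> : (W + e / 2) ^+ 4 = W ^+ 4 + 2 * e * W ^+ 3 +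
     (3 / 2 * e ^+ 2 * W ^+ 2 + e ^+ 3 * W / 2 + e ^+ 4 / 16) by field.
  apply: le_trans (_ : W ^+ 4 + 2 * e * W ^+ 3 <= _); last first.
    rewrite lerDl !addr_ge0 ?divr_ge0 ?mulr_ge0 ?exprn_ge0 //; lra.
  have h3 : 4 * K * W ^+ 2 <= 2 * e * W ^+ 3.
    have -> : 4 * K * W ^+ 2 = (2 * K) * (2 * W ^+ 2) by ring.
    have -> : 2 * e * W ^+ 3 = (e * W) * (2 * W ^+ 2) by ring.
    by rewrite ler_wpM2r // mulr_ge0 // sqr_ge0.
  have h4 : `|y| ^+ 4 <= K * W ^+ 2.
    apply: le_trans (_ : K * 1 <= _); first by rewrite /K mulr1 lerDr.
    by rewrite ler_wpM2l ?exprn_ege1 // (le_trans _ K1).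
  by lra.
by lra.
Qed.

(** Odd coordinates count too; they are what prevents consecutive basis vectors from being
    disjoint. *)
Definition perp a b := forall i, a i * b i = 0.

(** The two sides of the equation differ by 12 times the sum of the (a i b i)^2. Only norms occur in
    it, so linear isometries respect [perp]. *)
Lemma perpP a b :
  perp a b <-> `|a + b| ^+ 4 + `|a - b| ^+ 4 = 2 * `|a| ^+ 4 + 2 * `|b| ^+ 4.
Proof.
have c2 : 2 * psum4 a n + 2 * psum4 b n @[n --> \oo] --> 2 * `|a| ^+ 4 + 2 * `|b| ^+ 4.
  by apply: cvgD; apply: cvgMr; exact: psum4_cvg_norm.
split=> [ab|ab].
  apply: (cvgn_unique (@sum4_cvg a b)).
  apply: cvg_trans c2; apply: near_eq_cvg; apply: nearW => n /=.
  by rewrite psum4DB big1 ?mulr0 ?addr0 // => i _; rewrite ab expr0n.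
pose D n := \sum_(i < n) (a i * b i) ^+ 2.
have Dnd : nondecreasing_seq D.
  by apply/nondecreasing_seqP => n; rewrite /D big_ord_recr /= lerDl sqr_ge0.
have D0 : D n @[n --> \oo] --> (0 : R).
  have h := cvgB (@sum4_cvg a b) c2; rewrite ab subrr in h.
  have h2 : 12^-1 * (12 * D n) @[n --> \oo] --> 12^-1 * (0 : R).
    apply: cvgMr; suff -> : (fun n => 12 * D n) = (fun n : nat => psum4 (seq_of (a + b)) n +
      psum4 (seq_of (a - b)) n) - (fun n => 2 * psum4 a n + 2 * psum4 b n) by exact: h.
    apply/funext => n; rewrite fctE psum4DB /D.
    by rewrite addrAC subrr add0r.
  rewrite mulr0 in h2; apply: cvg_trans h2; apply: near_eq_cvg; apply: nearW => n /=.
  by rewrite mulrA mulVf ?mul1r.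
move=> i; apply/eqP; rewrite -sqrf_eq0 eq_le sqr_ge0 andbT.
apply: le_trans (_ : D i.+1 <= _).
  by rewrite /D big_ord_recr /= lerDr sumr_ge0 // => j _; rewrite sqr_ge0.
rewrite -(cvg_lim (@norm_hausdorff _ R) D0).
by apply: nondecreasing_cvgn_le => //; apply/cvg_ex; exists 0.
Qed.

End chain_geometry.

(** * Basis vectors, dimension and separability *)

Section chain_basis.
Variable R : realType.
Implicit Types (a b x y : chain R).

Lemma chain_rel a n : a n.*2.+1 = 2 * a n.*2 + a n.*2.+2.
Proof. by have [_ ->] := chainP a. Qed.

Lemma chain_ext a b : (forall n, a n.*2 = b n.*2) -> a = b.
Proof.
move=> ab; apply/val_inj/funext => i /=.
rewrite -[i]odd_double_half; case: (odd i) => /=; last exact: ab.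
by rewrite !add1n !chain_rel ab -doubleS ab.
Qed.

(** The free entries are those of a unit vector, and the odd ones are then forced: 2 on the edge
    above n and 1 on the edge below, which is missing for n = 0. *)
Definition basis_seq n (i : nat) : R :=
  if i == n.*2 then 1 else if i == n.*2.+1 then 2 else if i.+1 == n.*2 then 1 else 0.

Lemma basis_chain n : l4_chain (basis_seq n).
Proof.
split.
  exists (n.*2.+2%:R * 2 ^+ 4) => m.
  have bnd i : basis_seq n i ^+ 4 <= 2 ^+ 4.
    by rewrite /basis_seq; do 3?case: ifP => _; apply: ler_pow4; lra.
  apply: le_trans (_ : psum4 (basis_seq n) (n.*2.+2 + m) <= _).
    by apply: psum4_nd; rewrite leq_addl.
  rewrite /psum4 big_split_ord /= [X in _ + X]big1 ?addr0; last first.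
    move=> i _; rewrite /basis_seq !ifF ?expr0n //; lia.
  apply: le_trans (_ : \sum_(i < n.*2.+2) (2 ^+ 4 : R) <= _).
    by apply: ler_sum.
  by rewrite sumr_const card_ord mulr_natl.
move=> m; rewrite /basis_seq.
have [->|mn] := eqVneq m n.
  by rewrite !eqxx !ifF; [ring|lia..].
have [E|mn1] := eqVneq m.+1 n.
  by rewrite -E doubleS !eqxx !ifF; [ring|lia..].
by rewrite !ifF; [ring|lia..].
Qed.

Definition basis n : chain R := Chain (asboolT (basis_chain n)).

Lemma basisE n i : basis n i = basis_seq n i.
Proof. by []. Qed.

Lemma basis_even n m : basis n m.*2 = (m == n)%:R.
Proof.
rewrite basisE /basis_seq; have [->|mn] := eqVneq m n; first by rewrite eqxx.
by rewrite !ifF //; lia.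
Qed.

Lemma coordD a b i : (a + b) i = a i + b i. Proof. by []. Qed.
Lemma coordN a i : (- a) i = - a i. Proof. by []. Qed.
Lemma coordZ (t : R) a i : (t *: a) i = t * a i. Proof. by []. Qed.

Lemma coord_sum (I : Type) (r : seq I) (P : pred I) (F : I -> chain R) i :
  (\sum_(j <- r | P j) F j) i = \sum_(j <- r | P j) F j i.
Proof. by apply: (big_morph (fun a : chain R => a i)). Qed.

Definition trunc a N := \sum_(k < N) a k.*2 *: basis k.

Lemma trunc_even a N m : trunc a N m.*2 = if (m < N)%N then a m.*2 else 0.
Proof.
rewrite coord_sum; case: ltnP => mN.
  rewrite (bigD1 (Ordinal mN)) // coordZ basis_even eqxx mulr1.
  rewrite big1; [exact: addr0|move=> k km].
  rewrite coordZ basis_even [_ == _]negbTE ?mulr0 //.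
  by apply: contraNneq km => E; apply/eqP/val_inj.
rewrite big1 // => k _; rewrite coordZ basis_even.
by rewrite [_ == _]negbTE ?mulr0 // gtn_eqF // (leq_trans _ mN).
Qed.

(** Beyond index 2N the remainder agrees with a. Before it, the only entry that can survive is the
    odd one at 2N - 1, equal to [a N.*2], which is itself a term of the tail: hence the factor 2. *)
Lemma trunc_cvg a : trunc a N @[N --> \oo] --> a.
Proof.
suff tail N : `|a - trunc a N| ^+ 4 <= 2 * (`|a| ^+ 4 - psum4 a N.*2).
  have lim0 : 2 * (`|a| ^+ 4 - psum4 a N.*2) @[N --> \oo] --> (0 : R).
    rewrite -(mulr0 2) -(subrr (`|a| ^+ 4)); apply: cvgMr; apply: cvgB; first exact: cvg_cst.
    apply: (@cvg_comp _ _ _ double (psum4 a)); last exact: psum4_cvg_norm.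
    by under [double]funext => n do rewrite -mul2n; exact: cvg_mulnl.
  apply/cvgrPdist_le => e e0.
  have e4 : 0 < e ^+ 4 by rewrite exprn_gt0.
  move/cvgrPdist_le: lim0 => /(_ _ e4); apply: filterS => N /=.
  rewrite sub0r normrN => /(le_trans (ler_norm _)) hN.
  by rewrite -(@ler_pXn2r _ 4) ?nnegrE ?(ltW e0) // (le_trans (tail N)).
pose d := a - trunc a N.
have d_even m : d m.*2 = if (m < N)%N then 0 else a m.*2.
  by rewrite coordD coordN trunc_even; case: ifP => _; rewrite ?subrr ?subr0.
have d_odd m : d m.*2.+1 = if (m.+1 < N)%N then 0 else
    if (m < N)%N then a N.*2 else a m.*2.+1.
  rewrite (chain_rel d) -doubleS !d_even; case: (ltnP m.+1 N) => mN1.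
    by rewrite ifT ?mulr0 ?addr0 //; lia.
  case: (ltnP m N) => mN; last by rewrite chain_rel.
  by rewrite mulr0 add0r; congr (a _.*2); lia.
rewrite -/d; clearbody d; apply: (cvgr_to_le (@psum4_cvg_norm R d)); apply: nearW => n.
apply: le_trans (_ : psum4 d (N.*2 + n.+1) <= _).
  by apply: psum4_nd; lia.
have split_sum (u : nat -> R) : psum4 u (N.*2 + n.+1) =
    psum4 u N.*2 + \sum_(i < n.+1) u (N.*2 + i)%N ^+ 4.
  by rewrite /psum4 big_split_ord.
have dtail : \sum_(i < n.+1) d (N.*2 + i)%N ^+ 4 = \sum_(i < n.+1) a (N.*2 + i)%N ^+ 4.
  apply: eq_bigr => i _; congr (_ ^+ 4); rewrite -[(N.*2 + i)%N]odd_double_half.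
  case: (boolP (odd _)) => oi; rewrite ?add1n ?add0n.
    by rewrite d_odd !ifF //; lia.
  by rewrite d_even ifF //; lia.
have dhead : psum4 d N.*2 <= a N.*2 ^+ 4.
  case: N d_even d_odd {split_sum dtail} => [|N] d_even d_odd.
    by rewrite /psum4 big_ord0 pow4_ge0.
  rewrite doubleS /psum4 2!big_ord_recr /= d_odd ltnn ltnSn doubleS.
  rewrite d_even ltnSn expr0n addr0 big1 ?add0r // => i _.
  rewrite -[X in d X]odd_double_half.
  case: (boolP (odd _)) => oi; rewrite ?add1n ?add0n.
    by rewrite d_odd ifT ?expr0n //; have := ltn_ord i; lia.
  by rewrite d_even ifT ?expr0n //; have := ltn_ord i; lia.
have aN : a N.*2 ^+ 4 <= \sum_(i < n.+1) a (N.*2 + i)%N ^+ 4.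
  rewrite big_ord_recl /= addn0 lerDl sumr_ge0 // => i _; exact: pow4_ge0.
have := psum4_le_norm a (N.*2 + n.+1); rewrite -chain_normE split_sum => h.
rewrite split_sum dtail; lra.
Qed.

Lemma basis_neq0 n : basis n != 0.
Proof.
apply/eqP => /(congr1 (fun a : chain R => a n.*2)).
by rewrite basis_even eqxx; apply/eqP; rewrite oner_eq0.
Qed.

(** Writing n + 1 basis vectors in terms of n generators gives a matrix with a nonzero left kernel,
    that is, a linear relation that the even coordinates refute. *)
Lemma chain_infinite_dimensional : infinite_dimensional (chain R).
Proof.
move=> [n [v span]].
have [C CP] := choice (fun j : 'I_n.+1 => span (basis j)).
pose M : 'M[R]_(n.+1, n) := \matrix_(j, i) C j i.
have : kermx M != 0.
  by rewrite kermx_eq0 /row_free neq_ltn ltnS rank_leq_col.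
move/rowV0Pn => [u /sub_kermxP uM u0].
have : \sum_j u 0 j *: basis j = 0.
  under eq_bigr => j _ do rewrite CP scaler_sumr.
  rewrite exchange_big /= big1 // => i _.
  under eq_bigr => j _ do rewrite scalerA.
  rewrite -scaler_suml.
  have := congr1 (fun A : 'rV[R]_n => A 0 i) uM; rewrite !mxE.
  by under eq_bigr => j _ do rewrite mxE; move=> ->; rewrite scale0r.
move=> E; move/eqP: u0; apply; apply/rowP => k; rewrite mxE.
have := congr1 (fun a : chain R => a (nat_of_ord k).*2) E.
rewrite coord_sum (bigD1 k) // coordZ basis_even eqxx mulr1 big1; first by rewrite /= addr0 => ->.
move=> j jk; rewrite coordZ basis_even [_ == _]negbTE ?mulr0 //.
by apply: contraNneq jk => kj; apply/eqP/val_inj.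
Qed.

Lemma chain_noncollinear x : exists y, forall t : R, y <> t *: x.
Proof.
apply: contrapT => /forallNP H.
have col y : exists t : R, y = t *: x.
  by have /existsNP[t /contrapT] := H y; exists t.
have [s sE] := col (basis 0); have [t tE] := col (basis 1).
have coord n k : basis n k.*2 = (k == n)%:R by exact: basis_even.
have s0 : s * x 0 = 1 by rewrite -coordZ -sE (coord 0%N 0%N).
have s1 : s * x 2 = 0 by rewrite -coordZ -sE (coord 0%N 1%N).
have t1 : t * x 2 = 1 by rewrite -coordZ -tE (coord 1%N 1%N).
have : s * x 0 * (t * x 2) = 0 by rewrite mulrACA [x 0 * x 2]mulrC mulrACA s1 mul0r.
by rewrite s0 t1 mulr1; apply/eqP; rewrite oner_eq0.
Qed.

Lemma chain_separable : separable (chain R).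
Proof.
pose f (s : seq rat) : chain R := \sum_(k < size s) ratr s`_k *: basis k.
exists (range f); split.
  by apply: (sub_countable (card_image_le f setT)); exact: countableP.
have approx N (c : nat -> R) (e : R) : 0 < e -> exists2 s, size s = N &
    `|\sum_(k < N) c k *: basis k - f s| <= e.
  elim: N e => [|N IHN] e e0.
    by exists [::] => //; rewrite /f /= !big_ord0 subr0 normr0 ltW.
  have e2 : 0 < e / 2 by rewrite divr_gt0.
  have [s sN sE] := IHN _ e2.
  have b0 : 0 < `|basis N| by rewrite normr_gt0 basis_neq0.
  have [q] := @rat_in_itvoo R (c N) (c N + e / 2 / `|basis N|) ltac:(by rewrite ltrDl divr_gt0).
  rewrite in_itv /= => /andP[q1 q2].
  exists (rcons s q); first by rewrite size_rcons sN.
  rewrite /f size_rcons sN !big_ord_recr /=.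
  rewrite nth_rcons sN ltnn eqxx.
  have -> : \sum_(i < N) ratr (rcons s q)`_i *: basis i = f s.
    rewrite /f sN; apply: eq_bigr => i _; by rewrite nth_rcons sN ltn_ord.
  rewrite opprD addrACA -scalerBl [e](_ : _ = e / 2 + e / 2); last by field.
  apply: le_trans (ler_normD _ _) _; apply: lerD => //.
  rewrite normrZ -ler_pdivlMr // distrC ger0_norm ?subr_ge0 ?ltW //.
  by lra.
apply/dense_normP => x e e0.
have e2 : 0 < e / 2 by rewrite divr_gt0.
have /cvgrPdist_lt/(_ _ e2)/filter_ex[N xN] := @trunc_cvg x.
have [s _ sE] := approx N (fun k => x k.*2) _ e2.
exists (f s); first by exists s.
rewrite -(subrK (trunc x N) x) -addrA [e](_ : _ = e / 2 + e / 2); last by field.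
by apply: le_lt_trans (ler_normD _ _) _; apply: ltr_leD.
Qed.

End chain_basis.

(** * Its linear isometries *)

Section perp_chain.
Variable R : realType.
Implicit Types (a b x y z : chain R).

(** Distance at most 1 on the half-line: every vertex is adjacent to itself. *)
Definition adjacent (m n : nat) := (m <= n.+1)%N && (n <= m.+1)%N.

(** The edge coordinate between k and k + 1 does the work: if x at k and y at k + 1 were nonzero,
    the even coordinates would force y at k and x at k + 1 to vanish, and the product on the edge
    would be 2 x y, not 0. *)
Lemma perp_evenP x y :
  perp x y <-> forall m n, adjacent m n -> x m.*2 = 0 \/ y n.*2 = 0.
Proof.
split=> [xy m n /andP[mn nm]|H i].
  have even k : x k.*2 = 0 \/ y k.*2 = 0.
    by have /eqP := xy k.*2; rewrite mulf_eq0 => /orP[/eqP|/eqP]; [left|right].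
  have odd k : 2 * x k.*2 + x k.+1.*2 = 0 \/ 2 * y k.*2 + y k.+1.*2 = 0.
    rewrite !doubleS -!chain_rel.
    by have /eqP := xy k.*2.+1; rewrite mulf_eq0 => /orP[/eqP|/eqP]; [left|right].
  have : [\/ m = n, m = n.+1 | n = m.+1].
    by have [|mn'|nm'] := ltngtP m n; [constructor 3; lia|constructor 2; lia|constructor 1].
  case=> ->; first exact: even.
    by case: (odd n) => h; case: (even n) => h'; case: (even n.+1) => h'';
      try (left; lra); try (right; lra).
  by case: (odd m) => h; case: (even m) => h'; case: (even m.+1) => h'';
      try (left; lra); try (right; lra).
have ad k : adjacent k k by rewrite /adjacent; lia.
have ad1 k : adjacent k k.+1 by rewrite /adjacent; lia.
have ad2 k : adjacent k.+1 k by rewrite /adjacent; lia.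
rewrite -[i]odd_double_half; set k := i./2; case: (odd i) => /=.
  rewrite add1n !chain_rel -doubleS.
  have := H _ _ (ad k); have := H _ _ (ad k.+1).
  have := H _ _ (ad1 k); have := H _ _ (ad2 k).
  move=> [] h1 [] h2 [] h3 [] h4; rewrite ?h1 ?h2 ?h3 ?h4; ring.
by rewrite add0n; case: (H _ _ (ad k)) => ->; ring.
Qed.

Lemma perp_basisP x n : perp x (basis R n) <-> forall m, adjacent m n -> x m.*2 = 0.
Proof.
split=> [/perp_evenP H m mn|H].
  case: (H m n mn) => //; rewrite basis_even eqxx => /eqP; by rewrite oner_eq0.
apply/perp_evenP => m k mk; rewrite basis_even.
by have [E|] := eqVneq k n; [left; apply: H; rewrite -E|right].
Qed.

Lemma perp_basis m n : perp (basis R m) (basis R n) <-> ~~ adjacent m n.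
Proof.
split=> [/perp_basisP H|mn].
  by apply/negP => /H; rewrite basis_even eqxx => /eqP; rewrite oner_eq0.
apply/perp_basisP => k kn; rewrite basis_even; case: eqVneq => // E.
by move: mn; rewrite -E kn.
Qed.

Lemma perp_sym x y : perp x y -> perp y x.
Proof. by move=> xy i; rewrite mulrC. Qed.

Lemma multiple_of_basis x n : (forall m, m != n -> x m.*2 = 0) -> x = x n.*2 *: basis R n.
Proof.
move=> H; apply: chain_ext => m; rewrite coordZ basis_even.
by have [->|mn] := eqVneq m n; rewrite ?mulr1 // mulr0 H.
Qed.

(* Up to scaling, the atoms are the basis vectors except [basis 1], which
   dominates [basis 0]. *)
Definition atom x := x != 0 /\
  forall y, (forall z, perp z x -> perp z y) -> exists c : R, y = c *: x.

Lemma atom_basis n : n != 1%N -> atom (basis R n).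
Proof.
move=> n1; split; first exact: basis_neq0.
move=> y H; exists (y n.*2); apply: multiple_of_basis => m mn.
(* A vertex adjacent to m but not to n, on the far side of m. For m = 0 it is 0 itself, which works
   because n is not 1. *)
pose k := if (n < m)%N then m.+1 else m.-1.
have kn : ~~ adjacent k n by rewrite /adjacent /k; case: ifP; lia.
have /H/perp_sym/perp_basisP Hk : perp (basis R k) (basis R n) by apply/perp_basis.
by apply: Hk; rewrite /adjacent /k; case: ifP; lia.
Qed.

(** If x is nonzero at n, whatever is disjoint from x vanishes around n and is disjoint from
    [basis n]; so [basis n] is a multiple of x. *)
Lemma atomP x : atom x -> exists n c, [/\ n != 1%N, c != 0 & x = c *: basis R n].
Proof.
move=> [x0 H].
have [n xn] : exists n, x n.*2 != 0.
  apply: contrapT => /forallNP h; move/eqP: x0; apply; apply: chain_ext => n.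
  by have /negP := h n; rewrite negbK => /eqP.
have [c cE] : exists c : R, basis R n = c *: x.
  apply: H => z zx; apply/perp_basisP => m mn; move/perp_evenP: zx => /(_ m n mn).
  by case=> // /eqP; rewrite (negbTE xn).
have c0 : c != 0.
  apply/eqP => c0; have := basis_neq0 R n; by rewrite cE c0 scale0r eqxx.
have xE : x = c^-1 *: basis R n by rewrite cE scalerK.
exists n, c^-1; split; rewrite ?invr_eq0 //.
(* The neighbours of 0 are among those of 1, so an atom proportional to [basis 1] would also
   dominate [basis 0]. *)
apply/eqP => n1; have [d dE] : exists d : R, basis R 0 = d *: x.
  apply: H => z; rewrite xE n1 => zx; apply/perp_basisP => m mn.
  move/perp_evenP: zx => /(_ m 1%N); rewrite coordZ basis_even eqxx mulr1.
  have ad : adjacent m 1 by move: mn; rewrite /adjacent; lia.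
  by move=> /(_ ad)[] // /eqP; rewrite invr_eq0 (negbTE c0).
have := congr1 (fun a : chain R => a 2) dE.
rewrite xE n1 !coordZ (basis_even R 0 1) (basis_even R 1 1) /= mulr1.
move/esym/eqP; rewrite mulf_eq0 invr_eq0 (negbTE c0) orbF => /eqP d0.
by have := basis_neq0 R 0; rewrite dE d0 scale0r eqxx.
Qed.

(** When supports meet in the single coordinate j, the norms reveal whether x j and y j have the
    same sign. *)
Lemma norm4_diff x y j : (forall i, i != j -> x i * y i = 0) ->
  `|x + y| ^+ 4 - `|x - y| ^+ 4 = 8 * (x j * y j) * (x j ^+ 2 + y j ^+ 2).
Proof.
move=> H.
have c : psum4 (seq_of (x + y)) n - psum4 (seq_of (x - y)) n @[n --> \oo] -->
    `|x + y| ^+ 4 - `|x - y| ^+ 4 by apply: cvgB; exact: psum4_cvg_norm.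
apply: (cvgn_unique c); apply: cvg_near_cst; exists j.+1 => // n /= jn.
rewrite /psum4 -sumrB (bigD1 (Ordinal jn)) //= big1 ?addr0.
  by rewrite -[LHS]/((x j + y j) ^+ 4 - (x j - y j) ^+ 4); ring.
move=> i ij; rewrite -[LHS]/((x i + y i) ^+ 4 - (x i - y i) ^+ 4).
have -> : (x i + y i) ^+ 4 - (x i - y i) ^+ 4 = 8 * (x i * y i) * (x i ^+ 2 + y i ^+ 2).
  by ring.
by rewrite H ?mulr0 ?mul0r //; apply: contraNneq ij => E; apply/eqP/val_inj.
Qed.

End perp_chain.

Lemma path_rigid (s : nat -> nat) :
  (forall n, n != 1%N -> s n != 1%N) ->
  (forall m, m != 1%N -> exists2 n, n != 1%N & s n = m) ->
  (forall m n, m != 1%N -> n != 1%N -> adjacent (s m) (s n) = adjacent m n) ->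
  forall n, n != 1%N -> s n = n.
Proof.
move=> s1 surj adj.
(* Vertices with the same image have the same neighbours, themselves included, and this determines
   them. *)
have inj m n : m != 1%N -> n != 1%N -> s m = s n -> m = n.
  move=> m1 n1 E.
  have h k : k != 1%N -> adjacent m k = adjacent n k.
    by move=> k1; rewrite -(adj m k) // -(adj n k) // E.
  have := h m m1; have := h n n1.
  have m1' : m.+1 != 1%N \/ m = 0%N by case: m {E h m1}; [right|left].
  have n1' : n.+1 != 1%N \/ n = 0%N by case: n {E h n1 m1'}; [right|left].
  have := h m.+2 isT; have := h n.+2 isT.
  case: m1' => [/h|m0]; case: n1' => [/h|n0]; rewrite /adjacent; try lia.
have s0 : s 0 = 0%N.
  case E : (s 0) => [|k] //; have k0 := s1 0%N isT.
  have k2 : k.+2 != 1%N by lia.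
  have [m m1 sm] := surj k.+2 k2.
  have := adj m 0%N m1 isT; rewrite sm E /adjacent.
  have m0 : m != 0%N by apply/eqP => m0; move: sm; rewrite m0 E; lia.
  lia.
(* Otherwise [s 2] is at least 3 and has two neighbours, both coming from neighbours of 2 other than
   2 itself; but only 3 is available. *)
have s2 : s 2 = 2%N.
  have h2 := s1 2 isT.
  have h0 : s 2 != 0%N by apply/eqP => h; have := inj 2 0%N isT isT; rewrite s0 h; lia.
  apply/eqP; apply: contraT => h22.
  have [p p1 sp] := surj (s 2).+1 ltac:(lia).
  have [q q1 sq] := surj (s 2).-1 ltac:(lia).
  have := adj p 2 p1 isT; have := adj q 2 q1 isT; rewrite sp sq /adjacent => hq hp.
  have p2 : p != 2 by apply/eqP => h; move: sp; rewrite h; lia.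
  have q2 : q != 2 by apply/eqP => h; move: sq; rewrite h; lia.
  have p3 : p = 3 by lia.
  have q3 : q = 3 by lia.
  by move: sp sq; rewrite p3 q3; lia.
elim/ltn_ind=> n IHn n1.
case: n n1 IHn => [|[|[|n]]] // _ IHn.
have IH1 : s n.+2 = n.+2 by apply: IHn.
have := adj n.+3 n.+2 isT isT; rewrite IH1 {2}/adjacent => a.
have i2 : s n.+3 != n.+2.
  by apply/eqP => h; have := inj n.+3 n.+2 isT isT; rewrite h IH1; lia.
have i1 : s n.+3 != n.+1.
  case: n IHn IH1 a i2 => [|n] IHn IH1 a i2; first exact: s1.
  apply/eqP => h; have := inj n.+4 n.+2 isT isT; rewrite h IHn //; lia.
move: a; rewrite /adjacent; lia.
Qed.

(** * Norms on the span of the first three basis vectors *)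

Section low_norms.
Variable R : realType.

Definition quart (p q r : R) :=
  p ^+ 4 + (2 * p + q) ^+ 4 + q ^+ 4 + (2 * q + r) ^+ 4 + r ^+ 4 + (2 * r) ^+ 4.

Lemma norm4_low (p q r : R) :
  `|p *: basis R 0 + q *: basis R 1 + r *: basis R 2| ^+ 4 = quart p q r.
Proof.
have C i : (p *: basis R 0 + q *: basis R 1 + r *: basis R 2) i =
    p * basis_seq R 0 i + q * basis_seq R 1 i + r * basis_seq R 2 i by [].
rewrite (@norm4_fin R _ 6) => [|i i6]; last first.
  by rewrite C /basis_seq !ifF ?mulr0 ?addr0 //; lia.
rewrite /psum4; under eq_bigr => i _ do rewrite C.
rewrite !big_ord_recr big_ord0 /= /basis_seq /= /quart.
by ring.
Qed.

(** Comparing r = 1 with r = -1 isolates b: (b - 1)(64 b^2 + 64 b + 80) = 0, with a positive second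
    factor. At r = 0, the second difference in p gives g (17 g + 16) = 0, and g = -16/17 contradicts
    the equation at p = 0. Finally s = -1 fails at p = 1, where (2p + q)^4 would be 1 instead of
    81. *)
Lemma quart_solve (s g b : R) : s = 1 \/ s = -1 ->
  (forall p r, quart p 1 r = quart (p * s + g) b r) -> g = 0 /\ b = 1 /\ s = 1.
Proof.
move=> s1 H.
have b1 : b = 1.
  have : (b - 1) * (64 * b ^+ 2 + 64 * b + 80) = 0.
    have : (quart (0 * s + g) b 1 - quart 0 1 1) - (quart (0 * s + g) b (-1) - quart 0 1 (-1)) = 0.
      by rewrite !H !subrr.
    by move=> <-; rewrite /quart; ring.
  move/eqP; rewrite mulf_eq0 => /orP[/eqP|/eqP] hb; first by lra.
  have : 0 < 64 * b ^+ 2 + 64 * b + 80.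
    have -> : 64 * b ^+ 2 + 64 * b + 80 = 64 * (b + 1/2) ^+ 2 + 64 by field.
    by rewrite ltr_wpDl // mulr_ge0 // sqr_ge0.
  by rewrite hb ltxx.
have q0 : g ^+ 4 + (2 * g + 1) ^+ 4 = 1.
  by have := H 0 0; rewrite b1 /quart mul0r add0r; lra.
have q1 := H 1 0; have q2 := H (-1) 0.
have gg : g * (17 * g + 16) = 0.
  have h : (g + 1) ^+ 4 + (2 * (g + 1) + 1) ^+ 4 + ((g - 1) ^+ 4 + (2 * (g - 1) + 1) ^+ 4) = 84.
    by case: s1 q1 q2 => ->; rewrite b1 /quart; lra.
  have -> : g * (17 * g + 16) = ((g + 1) ^+ 4 + (2 * (g + 1) + 1) ^+ 4 +
     ((g - 1) ^+ 4 + (2 * (g - 1) + 1) ^+ 4) - 84 - 2 * (g ^+ 4 + (2 * g + 1) ^+ 4 - 1)) / 12.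
    by field.
  by rewrite h q0; lra.
have g0 : g = 0.
  move/eqP: gg; rewrite mulf_eq0 => /orP[/eqP //|/eqP hg].
  have {hg} gE : g = - (16 / 17) by lra.
  by exfalso; move: q0; rewrite gE; lra.
split=> //; split=> //; case: s1 => // sE.
by exfalso; move: q1; rewrite sE g0 b1 /quart; lra.
Qed.

End low_norms.

Section rigidity.
Variables (R : realType) (T U : chain R -> chain R).
Hypotheses (Tiso : linear_isometry T) (TK : cancel T U) (UK : cancel U T).
Implicit Types (x y : chain R).

Let TD x y : T (x + y) = T x + T y.
Proof. by have := Tiso.1 1 x y; rewrite !scale1r. Qed.

Let T0 : T 0 = 0.
Proof. by apply: (@addrI _ (T 0)); rewrite -TD !addr0. Qed.

Let TZ (c : R) x : T (c *: x) = c *: T x.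
Proof. by have := Tiso.1 c x 0; rewrite T0 !addr0. Qed.

Let TN x : T (- x) = - T x.
Proof. by rewrite -scaleN1r TZ scaleN1r. Qed.

Let Tnorm x : `|T x| = `|x|. Proof. exact: Tiso.2. Qed.

Let Tperp x y : perp (T x) (T y) <-> perp x y.
Proof. by rewrite !perpP -TN -!TD !Tnorm. Qed.

Let Tatom x : atom x -> atom (T x).
Proof.
move=> [x0 H]; split; first by rewrite -normr_eq0 Tnorm normr_eq0.
move=> y Hy; have [c cE] : exists c : R, U y = c *: x.
  apply: H => z zx; apply/Tperp; rewrite UK; apply: Hy; exact/Tperp.
by exists c; rewrite -TZ -cE UK.
Qed.

Let Uatom x : atom (T x) -> atom x.
Proof.
move=> [x0 H]; split; first by rewrite -normr_eq0 -Tnorm normr_eq0.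
move=> y Hy; have [c cE] : exists c : R, T y = c *: T x.
  by apply: H => z /=; rewrite -[z]UK => /Tperp/Hy/Tperp.
by exists c; apply: (can_inj TK); rewrite cE TZ.
Qed.

Let e := basis R.

(** T permutes the atoms up to scaling and preserves disjointness of supports, so it induces an
    adjacency-preserving map of the vertices other than 1. *)
Let T_basis_scale n : n != 1%N -> exists c : R, T (e n) = c *: e n.
Proof.
have [s sP] : exists s : nat -> nat, forall k, k != 1%N ->
    s k != 1%N /\ exists2 c : R, c != 0 & T (e k) = c *: e (s k).
  have h k : exists m, k != 1%N -> m != 1%N /\ exists2 c : R, c != 0 & T (e k) = c *: e m.
    have [k1|k1] := eqVneq k 1%N; first by exists 0%N.
    have [m [c [m1 c0 mE]]] := atomP (Tatom (atom_basis R k1)).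
    by exists m => _; split=> //; exists c.
  by have [s sP] := choice h; exists s.
have perpZ (c d : R) x y : c != 0 -> d != 0 -> perp (c *: x) (d *: y) <-> perp x y.
  move=> c0 d0; split=> H i; last by rewrite !coordZ mulrACA H mulr0.
  have /eqP := H i; rewrite !coordZ mulrACA mulf_eq0 mulf_eq0.
  by rewrite (negbTE c0) (negbTE d0) /= => /eqP.
have sid : forall k, k != 1%N -> s k = k.
  apply: path_rigid => [k k1|m m1|m k m1 k1]; first exact: (sP k k1).1.
    have : atom (T (U (e m))) by rewrite UK; exact: atom_basis.
    move=> /Uatom/atomP[k [c [k1 c0 E]]]; exists k => //.
    have [_ [d d0 dE]] := sP k k1.
    have : e m = (c * d) *: e (s k) by rewrite -[e m]UK E TZ dE scalerA.
    move=> /(congr1 (fun a : chain R => a (s k).*2)).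
    rewrite coordZ !basis_even eqxx mulr1; case: eqVneq => // _ /esym/eqP.
    by rewrite mulf_eq0 (negbTE c0) (negbTE d0).
  have [_ [c c0 cE]] := sP m m1; have [_ [d d0 dE]] := sP k k1.
  have h := Tperp (e m) (e k); rewrite cE dE (perpZ _ _ _ _ c0 d0) in h.
  apply/idP/idP; apply: contraTT => /perp_basis hp; apply/perp_basis.
    exact: (proj2 h).
  exact: (proj1 h).
by move=> n1; have [_ [c _]] := sP n n1; rewrite sid //; exists c.
Qed.

Lemma T_basis_sign n : n != 1%N -> T (e n) = e n \/ T (e n) = - e n.
Proof.
move=> /T_basis_scale[c E].
have := Tnorm (e n); rewrite E normrZ => h.
have : `|c| = 1.
  by apply: (@mulIf _ `|e n|); rewrite ?mul1r // normr_eq0 basis_neq0.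
move/eqP; rewrite eqr_norml ler01 andbT => /orP[/eqP->|/eqP->].
  by left; rewrite scale1r.
by right; rewrite scaleN1r.
Qed.

Let basis_prod n i : i != n.*2.+1 -> basis R n i * basis R n.+1 i = 0.
Proof.
move=> ni; rewrite !basisE /basis_seq doubleS.
by do 6?case: ifP; rewrite ?mulr0 ?mul0r //; lia.
Qed.

Let basis_prod_odd n : basis R n n.*2.+1 = 2 /\ basis R n.+1 n.*2.+1 = 1.
Proof.
rewrite !basisE /basis_seq doubleS !eqxx; split; first by rewrite ifF //; lia.
by rewrite !ifF //; lia.
Qed.

Let basis_norm_diff n : `|e n + e n.+1| ^+ 4 - `|e n - e n.+1| ^+ 4 = 80.
Proof.
rewrite (@norm4_diff R _ _ n.*2.+1) => [|i]; last exact: basis_prod.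
by have [-> ->] := basis_prod_odd n; ring.
Qed.

(** The sign passes from one vertex to the next: opposite signs would exchange the norms of the sum
    and the difference of two consecutive basis vectors, whose fourth powers differ by 80. *)
Let T_basis_tail (eps : R) : T (e 2) = eps *: e 2 -> eps ^+ 2 = 1 ->
  forall n, T (e n.+2) = eps *: e n.+2.
Proof.
move=> E eps2; elim=> [|n IHn] //.
have epsK : eps = 1 \/ eps = -1.
  have : (eps - 1) * (eps + 1) = 0 by rewrite (_ : _ * _ = eps ^+ 2 - 1); [rewrite eps2 subrr|ring].
  by move/eqP; rewrite mulf_eq0 => /orP[]/eqP h; [left|right]; lra.
have D := basis_norm_diff n.+2.
have h1 := Tnorm (e n.+2 + e n.+3); have h2 := Tnorm (e n.+2 - e n.+3).
rewrite !TD !TN IHn in h1 h2.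
case: epsK IHn h1 h2 => -> IHn; rewrite ?scaleN1r ?scale1r => h1 h2;
  case: (@T_basis_sign n.+3 isT) => E3 //; rewrite E3 in h1 h2.
  by rewrite h1 in D; have /eqP : (80 : R) = 0 by [rewrite -D; ring]; rewrite pnatr_eq0.
rewrite addrC distrC in h1; rewrite h1 in D.
by have /eqP : (80 : R) = 0 by [rewrite -D; ring]; rewrite pnatr_eq0.
Qed.

(** [e 1] is no atom and [e 0] has no neighbour among the atoms, so neither is reached by
    propagating signs. Disjointness from [e 3], [e 4], ... confines [T (e 1)] to the span of [e 0]
    and [e 1], and the norms settle the coefficients. *)
Let T_basis_low : (forall n, T (e n.+2) = e n.+2) ->
  T (e 1) = e 1 /\ T (e 0) = e 0.
Proof.
move=> tail.
have y0 k : (2 <= k)%N -> T (e 1) k.*2 = 0.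
  case: k => [|[|k]] // _.
  have : perp (T (e 1)) (T (e k.+3)) by apply/Tperp/perp_basis; rewrite /adjacent; lia.
  by rewrite tail => /perp_basisP; apply; rewrite /adjacent; lia.
pose g := T (e 1) 0; pose b := T (e 1) 2.
have ev n k : e n k.*2 = (k == n)%:R by exact: basis_even.
have TE : T (e 1) = g *: e 0 + b *: e 1.
  apply: chain_ext => -[|[|k]].
  - by rewrite coordD !coordZ (ev 0%N 0%N) (ev 1%N 0%N) mulr0 addr0 mulr1.
  - by rewrite coordD !coordZ (ev 0%N 1%N) (ev 1%N 1%N) mulr0 add0r mulr1.
  - by rewrite y0 // coordD !coordZ !ev !mulr0 addr0.
have low (p q r p' q' r' : R) :
    T (p *: e 0 + q *: e 1 + r *: e 2) = p' *: e 0 + q' *: e 1 + r' *: e 2 ->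
    quart p q r = quart p' q' r'.
  by move=> h; rewrite -!norm4_low -/e -h Tnorm.
have [s sE s1] : exists2 s : R, T (e 0) = s *: e 0 & s = 1 \/ s = -1.
  case: (@T_basis_sign 0%N isT) => h; first by exists 1; [rewrite scale1r|left].
  by exists (-1); [rewrite scaleN1r|right].
have h (p r : R) : quart p 1 r = quart (p * s + g) b r.
  apply: low; rewrite !TD !TZ scale1r TE sE tail scalerA scalerDl.
  by rewrite addrA.
have [g0 [b1 {}s1]] := quart_solve s1 h.
by rewrite TE sE g0 b1 s1 scale0r add0r !scale1r.
Qed.

Lemma isometry_fix : T (e 2) = e 2 -> forall x, T x = x.
Proof.
move=> E x.
have tail n : T (e n.+2) = e n.+2.
  by rewrite (@T_basis_tail 1) ?expr1n ?scale1r.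
have [e1 e0] := T_basis_low tail.
have fix_e n : T (e n) = e n by case: n => [|[|n]].
have fix_t N : T (trunc x N) = trunc x N.
  rewrite /trunc (big_morph T TD T0); apply: eq_bigr => k _.
  by rewrite TZ fix_e.
apply/eqP; rewrite -subr_eq0 -normr_eq0 eq_le normr_ge0 andbT.
apply/ler_addgt0Pr => d d0; rewrite add0r.
have d2 : 0 < d / 2 by rewrite divr_gt0.
have /cvgrPdist_lt/(_ _ d2)/filter_ex[N xN] := @trunc_cvg R x.
have -> : T x - x = T (x - trunc x N) - (x - trunc x N).
  by rewrite TD TN fix_t opprB addrA subrK.
apply: le_trans (ler_normB _ _) _; rewrite Tnorm.
by move: xN => /ltW xN; lra.
Qed.

End rigidity.

Theorem chain_isometry (R : realType) (T U : chain R -> chain R) :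
  linear_isometry T -> cancel T U -> cancel U T ->
  (forall x, T x = x) \/ (forall x, T x = - x).
Proof.
move=> Tiso TK UK.
have [E|E] := T_basis_sign Tiso TK UK (isT : 2%N != 1%N).
  by left; exact: (isometry_fix Tiso TK UK).
right=> x; apply: oppr_inj; rewrite opprK.
have Niso : linear_isometry (fun x => - T x).
  split=> [c y z|y]; last by rewrite normrN Tiso.2.
  by rewrite Tiso.1 opprD scalerN.
apply: (isometry_fix Niso (U := fun x => U (- x))) => [y|y|].
- by rewrite opprK TK.
- by rewrite UK opprK.
- by rewrite E opprK.
Qed.

(** * Independent trials *)

Section independent_trials.
Variables (R : realType) (d : measure_display) (T : measurableType d) (P : probability T R).
Implicit Types (D A B : set T).

Local Notation Pr D := (fine (P D)).

Lemma fine_prob D : measurable D -> P D = (Pr D)%:E.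
Proof. by move=> mD; rewrite fineK // fin_num_measure. Qed.

Lemma prob_split D A : measurable D -> measurable A ->
  Pr D = Pr (D `&` ~` A) + Pr (D `&` A).
Proof.
move=> mD mA; apply: EFin_inj; rewrite EFinD -!fine_prob //; last 2 first.
- exact: measurableI.
- by apply: measurableI => //; exact: measurableC.
by rewrite -setDE; exact: measureDI.
Qed.

Variables (A B E : nat -> set T) (p b c : R).
Hypotheses (mA : forall i, measurable (A i)) (mB : forall i, measurable (B i)).
Hypothesis mE : forall i, measurable (E i).
Hypothesis indep : forall s t : seq nat, uniq s -> uniq t ->
  P (\big[setI/setT]_(i <- s) A i `&` \big[setI/setT]_(i <- t) B i) =
  (p ^+ (size s + size t))%:E.
(* [1 - b 1_A - b 1_B - c 1_A 1_B] is the indicator function of [E]. *)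
Hypothesis trial : forall D i, measurable D ->
  Pr (D `&` E i) = Pr D - b * Pr (D `&` A i) - b * Pr (D `&` B i) - c * Pr (D `&` A i `&` B i).

Let q := 1 - b * p - b * p - c * (p * p).

(** The lists s and t of indices not yet tried make the induction work: expanding [E n] by [trial]
    adds n to s, to t or to both. *)
Lemma trials_prob n s t : uniq s -> uniq t -> all (leq n) s -> all (leq n) t ->
  Pr (\big[setI/setT]_(i <- s) A i `&` \big[setI/setT]_(i <- t) B i `&`
    \big[setI/setT]_(i < n) E i) = p ^+ (size s + size t) * q ^+ n.
Proof.
elim: n s t => [|n IHn] s t us ut ns nt.
  by rewrite big_ord0 setIT indep // expr0 mulr1.
pose M s t := \big[setI/setT]_(i <- s) A i `&` \big[setI/setT]_(i <- t) B i.
pose Q := \big[setI/setT]_(i < n) E i.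
have mM s' t' : measurable (M s' t' `&` Q).
  by apply: measurableI; [apply: measurableI|]; apply: bigsetI_measurable.
rewrite big_ord_recr /= setIA -/(M s t) -/Q trial //.
have IH s' t' : uniq s' -> uniq t' -> all (leq n) s' -> all (leq n) t' ->
  Pr (M s' t' `&` Q) = p ^+ (size s' + size t') * q ^+ n by exact: IHn.
have le_n u : all (leq n.+1) u -> all (leq n) u /\ n \notin u.
  move=> nu; split; first by apply: sub_all nu => k; exact: ltnW.
  by apply/negP => /(allP nu); rewrite ltnn.
have [ns' nns] := le_n _ ns; have [nt' nnt] := le_n _ nt.
have -> : M s t `&` Q `&` A n = M (n :: s) t `&` Q.
  by rewrite /M big_cons setIAC; congr (_ `&` _); rewrite setIC !setIA.
have -> : M s t `&` Q `&` B n = M s (n :: t) `&` Q.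
  by rewrite /M big_cons setIAC; congr (_ `&` _); rewrite -setIA [_ `&` B n]setIC.
have -> : M (n :: s) t `&` Q `&` B n = M (n :: s) (n :: t) `&` Q.
  by rewrite /M !big_cons setIAC; congr (_ `&` _); rewrite -setIA [_ `&` B n]setIC.
rewrite !IH //= ?us ?ut ?nns ?nnt ?ns' ?nt' ?leqnn //.
by rewrite !addSn !addnS !exprS /q; ring.
Qed.

Lemma trials_null : `|q| < 1 -> P.-negligible (\bigcap_i E i).
Proof.
move=> q1; have mE' : measurable (\bigcap_i E i) by exact: bigcap_measurable.
apply/negligibleP => //; apply: etrans (fine_prob mE') _; congr (_%:E).
have le n : Pr (\bigcap_i E i) <= q ^+ n.
  have := @trials_prob n [::] [::] isT isT isT isT.
  rewrite !big_nil !setTI mul1r => <-.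
  have mn : measurable (\big[setI/setT]_(i < n) E i) by exact: bigsetI_measurable.
  rewrite -lee_fin -!fine_prob //; apply: le_measure; [exact: mem_set|exact: mem_set|].
  by move=> w Ew; rewrite -bigcap_mkord => i _; exact: Ew.
apply/eqP; rewrite eq_le fine_ge0 ?measure_ge0 // andbT.
apply: (cvgr_to_ge (cvg_expr q1)); apply: nearW => n; exact: le.
Qed.

End independent_trials.

(** * Random graphs on dense sets *)

Lemma countable_negligible (R : realType) (d : measure_display) (T : measurableType d)
    (P : probability T R) (I : Type) (h : I -> nat) (N : I -> set T) :
  injective h -> (forall i, P.-negligible (N i)) -> P.-negligible (\bigcup_i N i).
Proof.
move=> hinj Nneg.
have : P.-negligible (\bigcup_k \bigcup_(i in [set i | h i = k]) N i).
  apply: negligible_bigcup => k.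
  have [[i hik]|none] := pselect (exists i, h i = k).
    apply: negligibleS (Nneg i) => w [j /= hjk Nj].
    by have <- : j = i by apply: hinj; rewrite hik.
  apply: negligibleS (negligible_set0 P) => w [j /= hjk _].
  by apply: none; exists j.
by apply: negligibleS => w [i _ Ni]; exists (h i) => //; exists i.
Qed.

Section dense_sequences.
Variables (R : realType) (X : normedModType R) (S : set X) (v : X).
Hypotheses (dS : dense S) (v0 : v != 0).

(** Because of the direction v, X has no isolated point: a nonempty open set stays nonempty and open
    when a point is removed. *)
Lemma dense_avoid (O : set X) (l : seq S) : open O -> O !=set0 ->
  exists2 z : S, O (val z) & z \notin l.
Proof.
elim: l O => [|y l IHl] O oO O0.
  have [x [Ox Sx]] := dS O0 oO.
  by exists (exist _ x (mem_set Sx)).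
have [||z [Oz zy] zl] := IHl (O `&` ~` [set val y]).
- apply: openI => //; apply: closed_openC.
  exact: (accessible_closed_set1 (hausdorff_accessible (@norm_hausdorff _ X))).
- have [x Ox] := O0; have [xy|] := pselect (x = val y); last by exists x.
  have /nbhs_ballP[e /= e0 xO] : nbhs x O by exact: open_nbhs_nbhs.
  have v1 : 0 < `|v| by rewrite normr_gt0.
  pose t := e / 2 / `|v|.
  have t0 : 0 < t by rewrite !divr_gt0.
  exists (x + t *: v); split.
    apply: xO; rewrite -ball_normE /= opprD addrA subrr sub0r normrN normrZ.
    by rewrite ger0_norm ?(ltW t0) // /t divfK ?gt_eqF // ltr_pdivrMr //; lra.
  move=> /= E; move/eqP: E; rewrite -xy -subr_eq0 addrAC subrr add0r scaler_eq0.
  by rewrite (negbTE v0) gt_eqF.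
by exists z => //; rewrite inE negb_or zl andbT; apply/eqP => E; apply: zy; rewrite E.
Qed.

Lemma dense_sequence (O : set X) (l : seq S) : open O -> O !=set0 ->
  exists z : nat -> S, [/\ injective z, forall i, O (val (z i)) & forall i, z i \notin l].
Proof.
move=> oO O0.
have [pk pkP] : exists pk : seq S -> S, forall s : seq S, O (val (pk s)) /\ pk s \notin s.
  have h (s : seq S) : exists z : S, O (val z) /\ z \notin s.
    by have [z ? ?] := dense_avoid s oO O0; exists z.
  by have [pk pkP] := choice h; exists pk.
pose L := fix L n := if n is m.+1 then pk (L m) :: L m else l.
have subL m n : {subset L m <= L (m + n)%N}.
  elim: n => [|n IHn]; first by rewrite addn0.
  by move=> x /IHn xL; rewrite addnS /= inE xL orbT.
have lt m n : (m < n)%N -> pk (L m) != pk (L n).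
  move=> mn; apply/eqP => E; have [_ /negP] := pkP (L n); apply.
  rewrite -E; have := subL m.+1 (n - m.+1)%N; rewrite subnKC //; apply.
  by rewrite /= inE eqxx.
exists (fun n => pk (L n)); split=> [m n E|i|i].
- by have [/lt|/lt|//] := ltngtP m n; rewrite E eqxx.
- exact: (pkP _).1.
apply/negP => il; have [_ /negP] := pkP (L i); apply.
by have := subL 0%N i; rewrite add0n; apply.
Qed.

End dense_sequences.

Lemma fset2_inj (K : choiceType) (x a b : K) : a != x ->
  [fset x; a]%fset = [fset x; b]%fset -> a = b.
Proof.
move=> ax /fsetP/(_ a); rewrite !inE eqxx orbT (negbTE ax) /=.
by move/esym/eqP.
Qed.

Lemma fset2_neq (K : choiceType) (x y a b : K) : x != y -> b != x ->
  [fset x; a]%fset <> [fset y; b]%fset.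
Proof.
move=> xy bx /fsetP/(_ x); rewrite !inE eqxx /= (negbTE xy) /=.
by rewrite eq_sym (negbTE bx).
Qed.

Section random_graphs.
Variables (R : realType) (d : measure_display) (T : measurableType d) (P : probability T R).
Variables (X : normedModType R) (S : set X) (p : R).
Implicit Types (G H : T -> set {fset S}).
Hypothesis p01 : 0 < p < 1.

Lemma close_pairs_lt (a b : S) : close_pairs S [fset a; b]%fset -> `|val a - val b| < 1.
Proof.
move=> [x [y [E xy lt1]]].
have [->|ab] := eqVneq a b; first by rewrite subrr normr0.
have ha : a \in [fset x; y]%fset by rewrite -E !inE eqxx.
have hb : b \in [fset x; y]%fset by rewrite -E !inE eqxx orbT.
move: ha hb; rewrite !inE => /orP[/eqP ax|/eqP ay] /orP[/eqP bx|/eqP by_].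
- by move: ab; rewrite ax bx eqxx.
- by rewrite ax by_.
- by rewrite ay bx distrC.
- by move: ab; rewrite ay by_ eqxx.
Qed.

Lemma edges_prob G (l : seq {fset S}) : is_random_graph P p G -> uniq l ->
  (forall e, e \in l -> close_pairs S e) ->
  P (\big[setI/setT]_(e <- l) edge_event G e) = (p ^+ size l)%:E.
Proof.
move=> [_ _ Gp Gind] ul lc.
pose F := [fset e in l]%fset.
have pe : perm_eq (enum_fset F) l.
  by apply: uniq_perm; [exact: fset_uniq|exact: ul|move=> e; rewrite /F inE].
have Fc i : i \in F -> close_pairs S i by rewrite /F inE; exact: lc.
have := Gind F Fc.
have -> : \bigcap_(i in [set` F]) edge_event G i = \big[setI/setT]_(e <- l) edge_event G e.
  rewrite -bigcap_seq; apply: eq_bigcapl.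
  by split=> e /=; rewrite /F inE.
move=> ->; rewrite (perm_big _ pe) /= big_seq.
under eq_bigr => e el do rewrite (Gp _ (lc _ el)).
rewrite -big_seq; elim: (l) => [|e s IHs] /=; first by rewrite big_nil.
by rewrite big_cons IHs exprS EFinM.
Qed.

Lemma edge_measurable G e : is_random_graph P p G -> close_pairs S e ->
  measurable (edge_event G e).
Proof. by move=> [_ + _ _]; apply. Qed.

Lemma sigma_graph_edges G (l : seq {fset S}) :
  sigma_graph G (\big[setI/setT]_(e <- l) edge_event G e).
Proof.
elim: l => [|e l IHl].
  by rewrite big_nil -[setT]setC0; apply: sigma_algebraC; exact: sigma_algebra0.
rewrite big_cons -[_ `&` _]setCK setCI.
apply: sigma_algebraC; rewrite -bigcup2E; apply: sigma_algebra_bigcup => -[|[|n]] /=.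
- by apply: sigma_algebraC; apply: sub_sigma_algebra; exists e.
- exact: sigma_algebraC.
- exact: sigma_algebra0.
Qed.

Lemma star_close (x : S) (z : nat -> S) i : z i != x -> `|val x - val (z i)| < 1 ->
  close_pairs S [fset x; z i]%fset.
Proof. by move=> zx lt1; exists x, (z i); split=> //; rewrite eq_sym. Qed.

(** The open unit balls around x and y share their midpoint, hence infinitely many points of S. Away
    from x and y, the edges from x and y to these points are all distinct. *)
Lemma common_neighbour (v : X) G (x y : S) : v != 0 -> dense S -> is_random_graph P p G ->
  x != y -> `|val x - val y| < 2 ->
  P.-negligible [set w | ~ exists z, G w [fset x; z]%fset /\ G w [fset y; z]%fset].
Proof.
move=> v0 dS rG xy lt2.
have [||z [zinj zO zxy]] := @dense_sequence R X S v dS v0 (ball (val x) 1 `&` ball (val y) 1) [:: x; y].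
- by apply: openI; exact: ball_open.
- exists (2^-1 *: (val x + val y)); split; rewrite -ball_normE /=.
    have -> : val x - 2^-1 *: (val x + val y) = 2^-1 *: (val x - val y).
      rewrite -[X in X - _ = _]scale1r [X in X *: _ - _](_ : 1 = 2^-1 + 2^-1); last by field.
      by rewrite scalerDl scalerDr scalerBr opprD addrA addrK.
    by rewrite normrZ ger0_norm ?invr_ge0 // mulrC ltr_pdivrMr // mul1r.
  have -> : val y - 2^-1 *: (val x + val y) = 2^-1 *: (val y - val x).
    rewrite -[X in X - _ = _]scale1r [X in X *: _ - _](_ : 1 = 2^-1 + 2^-1); last by field.
    by rewrite [val x + _]addrC scalerDl scalerDr scalerBr opprD addrA addrK.
  by rewrite normrZ ger0_norm ?invr_ge0 // mulrC ltr_pdivrMr // mul1r distrC.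
have zx i : z i != x by have := zxy i; rewrite !inE negb_or => /andP[].
have zy i : z i != y by have := zxy i; rewrite !inE negb_or => /andP[].
have cx i : close_pairs S [fset x; z i]%fset.
  by apply: star_close => //; have [h _] := zO i; move: h; rewrite -ball_normE.
have cy i : close_pairs S [fset y; z i]%fset.
  by apply: star_close => //; have [_ h] := zO i; move: h; rewrite -ball_normE.
pose A i := edge_event G [fset x; z i]%fset.
pose B i := edge_event G [fset y; z i]%fset.
have mA i : measurable (A i) by exact: edge_measurable rG _.
have mB i : measurable (B i) by exact: edge_measurable rG _.
have indep s t : uniq s -> uniq t ->
    P (\big[setI/setT]_(i <- s) A i `&` \big[setI/setT]_(i <- t) B i) =
    (p ^+ (size s + size t))%:E.
  move=> us ut.
  have -> : \big[setI/setT]_(i <- s) A i `&` \big[setI/setT]_(i <- t) B i =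
     \big[setI/setT]_(e <- [seq [fset x; z i]%fset | i <- s] ++ [seq [fset y; z i]%fset | i <- t])
        edge_event G e by rewrite big_cat !big_map.
  rewrite (edges_prob rG); first by rewrite size_cat !size_map.
    rewrite cat_uniq; apply/and3P; split.
    - by rewrite map_inj_uniq // => i j /fset2_inj E; apply: zinj; exact: E.
    - apply/hasPn => e /mapP[j jt ->]; apply/negP => /mapP[i js] /esym.
      by apply: fset2_neq.
    - by rewrite map_inj_uniq // => i j /fset2_inj E; apply: zinj; exact: E.
  by move=> e; rewrite mem_cat => /orP[]/mapP[i _ ->].
(* A trial fails with indicator 1 - 1_A 1_B, so b = 0, c = 1 and q = 1 - p^2. *)
have := @trials_null R d T P A B (fun i => ~` (A i `&` B i)) p 0 1 mA mB.
move=> /(_ _ indep) h; apply: negligibleS (h _ _ _).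
- by move=> w nw i _ [Ai Bi]; apply: nw; exists (z i).
- by move=> i; apply: measurableC; exact: measurableI.
- move=> D i mD; rewrite (prob_split P mD (measurableI _ _ (mA i) (mB i))) setIA; ring.
- by rewrite ltr_norml; move/andP: p01 => [p0 p1]; nra.
Qed.

Lemma star_isomorphism G H (x s : S) (z y : nat -> S) :
  is_random_graph P p G -> is_random_graph P p H -> independent_graphs P G H ->
  injective z -> injective y -> (forall i, z i != x) -> (forall i, y i != s) ->
  (forall i, `|val x - val (z i)| < 1) -> (forall i, `|val s - val (y i)| < 1) ->
  P.-negligible [set w | forall i, G w [fset x; z i]%fset <-> H w [fset s; y i]%fset].
Proof.
move=> rG rH ind zinj yinj zx ys xz1 sy1.
have cx i : close_pairs S [fset x; z i]%fset by exact: star_close.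
have cy i : close_pairs S [fset s; y i]%fset by exact: star_close.
pose A i := edge_event G [fset x; z i]%fset.
pose B i := edge_event H [fset s; y i]%fset.
have mA i : measurable (A i) by exact: edge_measurable rG _.
have mB i : measurable (B i) by exact: edge_measurable rH _.
have indep u t : uniq u -> uniq t ->
    P (\big[setI/setT]_(i <- u) A i `&` \big[setI/setT]_(i <- t) B i) =
    (p ^+ (size u + size t))%:E.
  move=> uu ut.
  have -> : \big[setI/setT]_(i <- u) A i =
      \big[setI/setT]_(e <- [seq [fset x; z i]%fset | i <- u]) edge_event G e by rewrite big_map.
  have -> : \big[setI/setT]_(i <- t) B i =
      \big[setI/setT]_(e <- [seq [fset s; y i]%fset | i <- t]) edge_event H e by rewrite big_map.
  rewrite ind; [|exact: sigma_graph_edges..].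
  rewrite (edges_prob rG); last 2 first.
  - by rewrite map_inj_uniq // => i j /fset2_inj E; apply: zinj; exact: E.
  - by move=> e /mapP[i _ ->].
  rewrite (edges_prob rH); last 2 first.
  - by rewrite map_inj_uniq // => i j /fset2_inj E; apply: yinj; exact: E.
  - by move=> e /mapP[i _ ->].
  by rewrite -EFinM !size_map exprD.
pose E i := (A i `&` B i) `|` (~` A i `&` ~` B i).
have mE i : measurable (E i).
  by apply: measurableU; apply: measurableI => //; exact: measurableC.
(* Agreement of the two edges has indicator 1 - 1_A - 1_B + 2 1_A 1_B, so b = 1, c = -2 and q = p^2
   + (1 - p)^2 < 1. *)
have := @trials_null R d T P A B E p 1 (-2) mA mB mE indep.
move=> h; apply: negligibleS (h _ _).
- move=> w iso i _; have [AB BA] := iso i.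
  by have [Ai|nAi] := pselect (A i w); [left; split=> //; exact: AB|right; split=> // /BA].
- move=> D i mD.
  have mDE : measurable (D `&` E i) by exact: measurableI.
  have mDC : measurable (D `&` ~` A i) by apply: measurableI => //; exact: measurableC.
  have h1 := prob_split P mDE (mA i).
  have h2 := prob_split P mD (mA i).
  have h3 := prob_split P mDC (mB i).
  have h4 := prob_split P (measurableI _ _ mD (mB i)) (mA i).
  have e1 : D `&` E i `&` ~` A i = D `&` ~` A i `&` ~` B i.
    apply/seteqP; split=> w /=; first by move=> [[Dw [[]|[]]]].
    by move=> [[Dw nA] nB]; split=> //; split=> //; right.
  have e2 : D `&` E i `&` A i = D `&` A i `&` B i.
    apply/seteqP; split=> w /=; first by move=> [[Dw [[]|[]]]].
    by move=> [[Dw nA] nB]; split=> //; split=> //; left.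
  have e3 : D `&` ~` A i `&` B i = D `&` B i `&` ~` A i by rewrite setIAC.
  have e4 : D `&` B i `&` A i = D `&` A i `&` B i by rewrite setIAC.
  by rewrite e1 e2 in h1; rewrite e3 in h3; rewrite e4 in h4; lra.
- by rewrite ltr_norml; move/andP: p01 => [p0 p1]; nra.
Qed.

End random_graphs.

(** * Graph isomorphisms are almost surely absent *)

Section rigid_spaces.
Variables (R : realType) (X : completeNormedModType R).
Hypothesis US : uniformly_smooth X.
Hypothesis nc : forall x : X, exists y, forall t : R, y <> t *: x.
Hypothesis rigid : forall T U : X -> X, linear_isometry T -> cancel T U -> cancel U T ->
  (forall x, T x = x) \/ (forall x, T x = - x).

(** The converse implication, from a common neighbour to distance below 2, follows from the first
    clause by the triangle inequality. *)
Definition adjacency_determines_distance (V : set X) (E : set {fset V}) :=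
  E `<=` close_pairs V /\ forall x y : V, x != y -> `|val x - val y| < 2 ->
    exists z, E [fset x; z]%fset /\ E [fset y; z]%fset.

Lemma isomorphism_step (S : set X) (G H : set {fset S}) (f : S -> S) : injective f ->
  adjacency_determines_distance G -> H `<=` close_pairs S ->
  (forall x y : S, G [fset x; y]%fset -> H [fset f x; f y]%fset) ->
  forall x y : S, `|val x - val y| < 2 -> `|val (f x) - val (f y)| < 2.
Proof.
move=> finj [_ Gd] Hc GH x y xy.
have [->|nxy] := eqVneq x y; first by rewrite subrr normr0.
have [z [/GH/Hc/close_pairs_lt xz /GH/Hc/close_pairs_lt yz]] := Gd x y nxy xy.
have -> : val (f x) - val (f y) = (val (f x) - val (f z)) - (val (f y) - val (f z)).
  by rewrite opprB addrA subrK.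
by apply: le_lt_trans (ler_normB _ _) _; lra.
Qed.

Lemma isomorphism_affine (S : set X) (G H : set {fset S}) (f : S -> S) : dense S ->
  adjacency_determines_distance G -> adjacency_determines_distance H -> bijective f ->
  (forall x y : S, G [fset x; y]%fset <-> H [fset f x; f y]%fset) ->
  exists b : bool, forall x y : S, val (f x) - val (f y) = (-1) ^+ b *: (val x - val y).
Proof.
move=> dS Gd Hd [g fK gK] GH.
(* Off S the extension takes an arbitrary value. *)
have ext (h : S -> S) : exists k : X -> X, forall s : S, k (val s) = val (h s).
  have e x : exists y, forall s : S, val s = x -> y = val (h s).
    have [[s <-]|ns] := pselect (exists s : S, val s = x).
      by exists (val (h s)) => t /val_inj ->.
    by exists x => s sx; case: ns; exists s.
  by have [k kP] := choice e; exists k => s; apply: kP.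
have [F FP] := ext f; have [K KP] := ext g.
have pt x : S x -> exists s : S, val s = x by move=> Sx; exists (exist _ x (mem_set Sx)).
have HG x y : H [fset x; y]%fset -> G [fset g x; g y]%fset.
  by move=> Hxy; apply/GH; rewrite !gK.
have fg : step_pair S 2 F K.
  split.
  - by move=> _ /pt[s <-]; rewrite FP; exact: set_valP.
  - by move=> _ /pt[s <-]; rewrite KP; exact: set_valP.
  - by move=> _ /pt[s <-]; rewrite FP KP fK.
  - by move=> _ /pt[s <-]; rewrite KP FP gK.
  move=> _ _ /pt[s <-] /pt[t <-]; rewrite !FP; split.
    by apply: (isomorphism_step (can_inj fK) Gd Hd.1) => x y /GH.
  move=> lt2; rewrite -[s]fK -[t]fK.
  exact: (isomorphism_step (can_inj gK) Hd Gd.1 HG).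
have [T [U [Tiso TK UK TE]]] := step_pair_isometry US dS (ltr0Sn R 1) nc fg.
have E s t : val (f s) - val (f t) = T (val s - val t).
  by rewrite -!FP TE //; exact: set_valP.
have [Tid|Tneg] := rigid Tiso TK UK; [exists false|exists true] => x y; rewrite E.
  by rewrite expr0 scale1r Tid.
by rewrite expr1 scaleN1r Tneg.
Qed.

Variables (d : measure_display) (T : measurableType d) (P : probability T R).
Variables (p : R) (S : set X).
Hypotheses (p01 : 0 < p < 1) (cS : countable S) (dS : dense S).

Let v0 : exists v : X, v != 0.
Proof.
have [v vP] := nc 0; exists v; apply/eqP => v0.
by have := vP 0; rewrite v0 scaler0.
Qed.

Let hS : exists h : S -> nat, injective h.
Proof.
have /countable_injP[h hinj] := cS; exists (fun s : S => h (val s)) => s t E.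
by apply: val_inj; apply: hinj E; apply: mem_set; exact: set_valP.
Qed.

Lemma ae_adjacency_determines_distance (G : T -> set {fset S}) : is_random_graph P p G ->
  P.-negligible [set w | ~ adjacency_determines_distance (G w)].
Proof.
move=> rG; have [v vn0] := v0; have [h hinj] := hS.
pose N (xy : S * S) := [set w | [/\ xy.1 != xy.2, `|val xy.1 - val xy.2| < 2
  & ~ exists z, G w [fset xy.1; z]%fset /\ G w [fset xy.2; z]%fset]].
have Nneg xy : P.-negligible (N xy).
  have [[n12 lt2]|none] := pselect (xy.1 != xy.2 /\ `|val xy.1 - val xy.2| < 2).
    by apply: negligibleS (common_neighbour p01 vn0 dS rG n12 lt2) => w [].
  by apply: negligibleS (negligible_set0 P) => w [h1 h2 _]; apply: none.
have inj : injective (fun xy : S * S => choice.pickle (h xy.1, h xy.2)).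
  move=> [x y] [x' y'] /= /(pcan_inj (@choice.pickleK _)) [E1 E2].
  by rewrite (hinj _ _ E1) (hinj _ _ E2).
apply: negligibleS (countable_negligible inj Nneg) => w /= nd.
apply: contrapT => none; apply: nd; split; first by have [+ _ _ _] := rG; apply.
move=> x y nxy lt2; apply: contrapT => nz; apply: none.
by exists (x, y).
Qed.

Lemma ae_not_isomorphic (G H : T -> set {fset S}) : is_random_graph P p G ->
  is_random_graph P p H -> independent_graphs P G H ->
  P.-negligible [set w | graph_isomorphic (G w) (H w)].
Proof.
move=> rG rH ind; have [v vn0] := v0; have [h hinj] := hS.
have [x Sx _] := (dense_normP S).1 dS 0 1 ltr01.
pose x0 : S := exist _ x (mem_set Sx).
have [||z [zinj z1 zx]] := @dense_sequence R X S v dS vn0 (ball (val x0) 1) [:: x0].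
- exact: ball_open.
- by exists (val x0); exact: ballxx.
have {}zx i : z i != x0 by have := zx i; rewrite inE.
have {}z1 i : `|val x0 - val (z i)| < 1 by have := z1 i; rewrite -ball_normE.
pose image (bs : bool * S) (y : nat -> S) :=
  forall i, val (y i) - val bs.2 = (-1) ^+ bs.1 *: (val (z i) - val x0).
(* A sign and the image of [x0] determine y. If the affine map sends some [z i] outside S, no y
   exists and this event is empty. *)
pose N bs := [set w | exists2 y, image bs y &
  forall i, G w [fset x0; z i]%fset <-> H w [fset bs.2; y i]%fset].
have signn (b : bool) (u : X) : (-1) ^+ b *: u = 0 -> u = 0.
  by move/eqP; rewrite scaler_eq0 signr_eq0 => /eqP.
have Nneg bs : P.-negligible (N bs).
  have [[y yP]|none] := pselect (exists y, image bs y); last first.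
    by apply: negligibleS (negligible_set0 P) => w [y yP _]; apply: none; exists y.
  apply: negligibleS (@star_isomorphism _ _ _ P _ S p p01 G H x0 bs.2 z y rG rH ind zinj _ zx _ z1 _).
  - move=> w [y' y'P iso] i; rewrite (iso i); suff -> : y' i = y i by [].
    apply: val_inj; apply: (@subIr _ (val bs.2)); by rewrite y'P yP.
  - move=> i j E; apply: zinj; apply: val_inj; apply/eqP; rewrite -subr_eq0; apply/eqP.
    apply: (signn bs.1); have := yP i; rewrite E yP => E'.
    have -> : val (z i) - val (z j) = (val (z i) - val x0) - (val (z j) - val x0).
      by rewrite opprB addrA subrK.
    by rewrite scalerBr E' subrr.
  - move=> i; apply/eqP => E; have := yP i; rewrite E subrr => /esym/signn/eqP.
    by rewrite subr_eq0 => /eqP/val_inj/eqP; rewrite (negbTE (zx i)).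
  - by move=> i; rewrite distrC yP normrZ normrX normrN1 expr1n mul1r distrC.
have inj : injective (fun bs : bool * S => choice.pickle (bs.1, h bs.2)).
  move=> [b s] [b' s'] /= /(pcan_inj (@choice.pickleK _)) [-> E2].
  by rewrite (hinj _ _ E2).
have N1 := ae_adjacency_determines_distance rG.
have N2 := ae_adjacency_determines_distance rH.
have N3 := countable_negligible inj Nneg.
apply: negligibleS (negligibleU (negligibleU N1 N2) N3) => w [f fbij iso].
have [Gd|] := pselect (adjacency_determines_distance (G w)); last by left; left.
have [Hd|] := pselect (adjacency_determines_distance (H w)); last by left; right.
right; have [b bP] := isomorphism_affine dS Gd Hd fbij iso.
exists (b, f x0) => //; exists (fun i => f (z i)); first by move=> i; exact: bP.
by move=> i; exact: iso.
Qed.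

End rigid_spaces.

Theorem theorem6 (R : realType) :
  exists X : completeNormedModType R,
    infinite_dimensional X /\ separable X /\
    forall p : R, 0 < p < 1 ->
      forall S : set X, countable S -> dense S -> strongly_non_Rado p S.
Proof.
exists (chain R); split; first exact: chain_infinite_dimensional.
split; first exact: chain_separable.
move=> p p01 S cS dS d T P G H rG rH ind.
have := ae_not_isomorphic (@chain_uniformly_smooth R) (@chain_noncollinear R)
  (@chain_isometry R) p01 cS dS rG rH ind.
by apply: negligibleS => w /= /contrapT.
Qed.
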